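(* Let $P_\sigma(n)$ be defined by $\sum_{n=0}^{\infty}P_\sigma(n)q^n=\sigma(q)$, where $\sigma(q)=\sum_{n=0}^{\infty}\dfrac{q^{(n+1)(n+2)/2}(-q;q)_n}{(q;q^2)_{n+1}}$. Then for every integer $n\ge 0$, $$P_\sigma(2n+1)=\sum_{k=0}^{\infty}p_{2d}\left(n-\frac{3k^2+3k}{2}\right)=p_{2d}(n)+p_{2d}(n-3)+p_{2d}(n-9)+\cdots.$$
   Context: Notation: $(b;q)_n=\prod_{k=0}^{n-1}(1-bq^k)$ and $\ell_k=\prod_{m\ge1}(1-q^{km})$. $p_{2d}(n)$ is the number of partitions of $n$ into distinct parts with $2$ copies (colours), with $\sum_{n\ge0}p_{2d}(n)q^n=(\ell_2/\ell_1)^2$. Convention: $p_{2d}(m)=0$ for $m<0$. *)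

(* Defs.v *)
From mathcomp Require Import all_boot all_order all_algebra.
From mathcomp Require Import boolp classical_sets functions cardinality fsbigop.

Set Implicit Arguments.
Unset Strict Implicit.
Unset Printing Implicit Defensive.

Import Order.TTheory GRing.Theory Num.Theory.
Local Open Scope ring_scope.

(* All q-series are formal power series in q over the integers, given by their
   coefficient sequences nat -> int; the indeterminate q is 'X : {poly int}. *)

(* (b; Q)_n *)
Definition qpoch (b Q : {poly int}) (n : nat) : {poly int} :=
  \prod_(k < n) (1 - b * Q ^+ k).

(* The power series expansion of f / g when g has constant term 1: the
   coefficient of q^m in f * (1 + (1 - g) + (1 - g)^2 + ...) only involves the
   powers (1 - g)^k with k <= m.  Its defining property is fps_divP. *)
Definition fps_div (f g : {poly int}) (m : nat) : int :=
  (f * \sum_(k < m.+1) (1 - g) ^+ k)`_m.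

Definition sigma_term (n : nat) : nat -> int :=
  fps_div ('X^(((n + 1) * (n + 2)) %/ 2) * qpoch (- 'X) 'X n)
          (qpoch 'X 'X^2 n.+1).

(* The coefficient of q^m in sigma(q).  The sum over all n is taken
   coefficientwise; it is finite by sigma_term_finite. *)
Definition Psigma (m : nat) : int :=
  \sum_(n \in [set: nat]%classic) sigma_term n m.

(* Coloured partitions of n into distinct parts: a coloured part
   (i, c) : 'I_n * 'I_2 has size i + 1 and colour c, and a partition is a set of
   coloured parts, so that each size occurs at most once in each colour. *)
Definition p2d_nat (n : nat) : nat :=
  #|[set A : {set 'I_n * 'I_2} | \sum_(x in A) (x.1 : nat).+1 == n]%N|.

Definition p2d (m : int) : nat :=
  if m is Posz n then p2d_nat n else 0%N.

Lemma coef_expr_low (p : {poly int}) n m :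
  p`_0 = 0 -> (m < n)%N -> (p ^+ n)`_m = 0.
Proof.
move=> p0; elim: n m => [//|n IHn] m ltmn.
rewrite exprS coefM big1 // => -[[|i] /= lti] _; first by rewrite p0 mul0r.
case: m ltmn lti => // m ltmn _.
by rewrite IHn ?mulr0 //= subSS (leq_ltn_trans (leq_subr _ _)).
Qed.

Lemma fps_div_widen (f g : {poly int}) (m N : nat) :
  g`_0 = 1 -> (m < N)%N ->
  fps_div f g m = (f * \sum_(k < N) (1 - g) ^+ k)`_m.
Proof.
move=> g0 ltmN; have h0 : (1 - g)`_0 = 0 by rewrite coefB coef1 g0 subrr.
rewrite /fps_div !coefM; apply: eq_bigr => i _; congr (_ * _).
rewrite !coef_sum (big_ord_widen N (fun k => ((1 - g) ^+ k)`_(m - i))) //.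
rewrite big_mkcond; apply: eq_bigr => k _; case: ifP => // /negbT.
rewrite -leqNgt => ltmk; rewrite coef_expr_low //.
exact: leq_ltn_trans (leq_subr _ _) ltmk.
Qed.

Lemma geom_sum_trunc (g : {poly int}) (N : nat) :
  g * \sum_(k < N) (1 - g) ^+ k = 1 - (1 - g) ^+ N.
Proof. by rewrite -[RHS]opprB subrX1 addrAC subrr add0r mulNr opprK. Qed.

Lemma coef_geom_sum_trunc (f g : {poly int}) (m : nat) : g`_0 = 1 ->
  (f * (g * \sum_(k < m.+1) (1 - g) ^+ k))`_m = f`_m.
Proof.
move=> g0; have h0 : (1 - g)`_0 = 0 by rewrite coefB coef1 g0 subrr.
rewrite geom_sum_trunc mulrBr mulr1 coefB coefM big1 ?subr0 // => i _.
by rewrite coef_expr_low ?mulr0 // ltnS leq_subr.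
Qed.

Lemma fps_divP (f g : {poly int}) (m : nat) : g`_0 = 1 ->
  \sum_(i < m.+1) g`_i * fps_div f g (m - i) = f`_m.
Proof.
move=> g0.
under eq_bigr => i _ do
  rewrite (@fps_div_widen f g (m - i) m.+1) ?ltnS ?leq_subr //.
by rewrite -coefM mulrCA coef_geom_sum_trunc.
Qed.

Lemma fps_div_mulK (f g : {poly int}) (m : nat) : g`_0 = 1 ->
  fps_div (g * f) g m = f`_m.
Proof. by move=> g0; rewrite /fps_div -mulrA mulrCA coef_geom_sum_trunc. Qed.

Lemma qpoch_coef0 (b Q : {poly int}) n : b`_0 = 0 -> (qpoch b Q n)`_0 = 1.
Proof.
move=> b0; rewrite /qpoch -horner_coef0 horner_prod big1 // => i _.
by rewrite hornerD hornerN hornerM (horner_coef0 b) b0 mul0r hornerC subr0.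
Qed.

Lemma sigma_term_eq0 (n m : nat) : (m <= n)%N -> sigma_term n m = 0.
Proof.
move=> lemn; rewrite /sigma_term /fps_div -mulrA coefXnM ifT //.
rewrite (leq_ltn_trans lemn) // leq_divRL // addn1 addn2 leq_mul2l /=.
by rewrite !ltnS.
Qed.

Lemma sigma_term_finite (m : nat) :
  Psigma m = \sum_(n < m) sigma_term n m.
Proof.
rewrite /Psigma (fsbig_ord _ m (fun n => sigma_term n m)).
apply/esym/fsbig_widen => // n [_ /= /negP]; rewrite -leqNgt.
exact: sigma_term_eq0.
Qed.

(* The generating function (l_2 / l_1)^2 of p_2d; the factors of l_1 and l_2
   with index m > n do not affect the coefficient of q^n. *)
Lemma p2d_gen (n : nat) :
  (p2d n)%:Z = fps_div ((\prod_(m < n) (1 - 'X^(2 * m.+1))) ^+ 2)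
                       ((\prod_(m < n) (1 - 'X^(m.+1))) ^+ 2) n.
Proof.
have -> : \prod_(m < n) (1 - 'X^(2 * m.+1)) =
    \prod_(m < n) (1 - 'X^(m.+1)) * \prod_(m < n) (1 + 'X^(m.+1)) :> {poly int}.
  rewrite -big_split /=; apply: eq_bigr => m _.
  by rewrite mulnC exprM -subr_sqr expr1n.
rewrite exprMn fps_div_mulK; last first.
  rewrite -horner_coef0 horner_exp horner_prod big1 ?expr1n // => i _.
  by rewrite hornerD hornerN hornerXn hornerC expr0n subr0.
have -> : (\prod_(m < n) (1 + 'X^(m.+1))) ^+ 2 =
    \prod_(x : 'I_n * 'I_2) ('X^((x.1 : nat).+1) + 1) :> {poly int}.
  rewrite -(pair_bigA _ (fun (m : 'I_n) (c : 'I_2) => 'X^(m.+1) + 1 : {poly int})).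
  rewrite -prodrXl; apply: eq_bigr => m _.
  by rewrite prodr_const card_ord addrC.
rewrite bigA_distr coef_sum /= /p2d_nat cardsE -sum1_card big_mkcond /=.
rewrite -natz natr_sum; apply: eq_bigr => A _.
rewrite -big_mkcond /= -expr_sum coefXn unfold_in eq_sym.
by rewrite -[eqn _ _]/(_ == _)%N; case: (_ == _)%N.
Qed.

(* Main.v *)
Require Import Defs.
From HB Require Import structures.
From mathcomp Require Import all_boot all_order all_algebra.
From mathcomp Require Import classical_sets fsbigop.
From mathcomp Require Import boolp.
From mathcomp Require Import zify ring.

(** Write phi(q) for the sum of q ^ (t ^ 2) over all integers t.  Both sides are
    power series coefficients: since (-q; q)_oo ^ 2 generates p_2d, the theorem
    says that the odd part O of sigma is

      O = q (-q^2; q^2)_oo ^ 2 * sum_(k >= 0) q ^ (3 k (k + 1))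

    ([odd_part_sigma]).  This is proved after multiplication by phi(-q^2) ^ 3,
    by means of indefinite theta series.

    First, sigma is such a series up to the factor phi(-q) ([phi_neg_sigma]):

      phi(-q) sigma(q) = (sum over r, s >= 0 minus sum over r, s < 0) of
                         (-1) ^ (r + s) q ^ (r^2 + s^2 + 4 r s + 2 r + 3 s + 1).

    This is a Bailey pair argument in which Bailey's lemma and the inversion of
    the pair are merged into two identities: phi(-q) times the j-th term of sigma
    is expanded as a series in m by [phi_term_sum], the sum over j at fixed
    n = m + j is finite, and it is evaluated by [inner_sum_qbin].  Both are
    proved by telescoping.

    Next multiply by phi(q).  The product phi(q) phi(-q) = phi(-q^2) ^ 2 is even,
    so the left-hand side becomes phi(-q^2) ^ 2 O in the odd part.  On the right,
    q ^ (t^2) times the (r, s) term has exponent of the parity of t + r + 1, so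
    the odd part is the sum over t = 2 c - r.  For fixed c, a translation of
    (r, s) turns the double sum into a monomial times the one for c = 0
    ([slice_shift]): it moves the boundary of the quadrants, but the strips
    swept by it contribute 0.  Hence ([odd_part_phi_hecke])

      odd part of phi(q) phi(-q) sigma(q)
        = q * (sum over c of (-1) ^ c q ^ (6 c^2 + 4 c)) * K(q),

    where K is the double sum for c = 0, up to a monomial.

    The series K satisfies phi(-q^2) K(q) = sum_(k >= 0) (-1)^k (2 k + 1) q^(k (k + 1))
    ([slice_product]).  Indeed phi(-q^2) merges with the sum over r into a sum
    over two independent integers a and b; for fixed b the rest of the sum is,
    except for b = -1, killed by symmetries.  This is the series form of the
    partial fraction expansion of the inverse of a theta function.

    It remains to compare three theta series and the series of cubes as infinite
    products ([product_identity]).  All four product formulas are limits of one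
    finite identity ([finite_triple_product]). *)

Set Implicit Arguments.
Unset Strict Implicit.
Unset Printing Implicit Defensive.

Import Order.TTheory GRing.Theory Num.Theory.
Local Open Scope ring_scope.

(** * Formal power series *)

(** The coefficient sequence is the series itself, so that [sigma_term n] and
    [Psigma] are series without any conversion. *)
Definition fps : Type := nat -> int.

HB.instance Definition _ := gen_eqMixin fps.
HB.instance Definition _ := gen_choiceMixin fps.

Lemma fpsP (f g : fps) : (forall n, f n = g n) -> f = g.
Proof. by move=> fg; apply/funext. Qed.

Definition fps_zero : fps := fun=> 0.
Definition fps_opp (f : fps) : fps := fun n => - f n.
Definition fps_add (f g : fps) : fps := fun n => f n + g n.
Definition fps_one : fps := fun n => (n == 0%N)%:R.
Definition fps_mul (f g : fps) : fps := fun n => \sum_(i < n.+1) f i * g (n - i)%N.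

Fact fps_addA : associative fps_add.
Proof. by move=> f g h; apply: fpsP => n; rewrite /fps_add addrA. Qed.
Fact fps_addC : commutative fps_add.
Proof. by move=> f g; apply: fpsP => n; rewrite /fps_add addrC. Qed.
Fact fps_add0 : left_id fps_zero fps_add.
Proof. by move=> f; apply: fpsP => n; rewrite /fps_add add0r. Qed.
Fact fps_addN : left_inverse fps_zero fps_opp fps_add.
Proof. by move=> f; apply: fpsP => n; rewrite /fps_add /fps_opp addNr. Qed.

HB.instance Definition _ :=
  GRing.isZmodule.Build fps fps_addA fps_addC fps_add0 fps_addN.

(** Only the coefficients below N of the factors matter for the coefficients
    below N of a product, so the associativity and commutativity of the product
    of series follow from those of the product of polynomials. *)
Definition trunc (N : nat) (f : fps) : {poly int} := \poly_(i < N) f i.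

Lemma coef_fps_mul N (f g : fps) n : (n < N)%N ->
  fps_mul f g n = (trunc N f * trunc N g)`_n.
Proof.
move=> ltnN; rewrite coefM /fps_mul; apply: eq_bigr => i _.
by have := ltn_ord i => lti; rewrite !coef_poly !ifT //; lia.
Qed.

Fact fps_mulC : commutative fps_mul.
Proof.
by move=> f g; apply: fpsP => n; rewrite !(@coef_fps_mul n.+1) // mulrC.
Qed.

Lemma fps_mul_trunc N (f g : fps) n (p : {poly int}) : (n < N)%N ->
  (forall i, (i < N)%N -> g i = p`_i) -> fps_mul f g n = (trunc N f * p)`_n.
Proof.
move=> ltnN gp; rewrite coefM /fps_mul; apply: eq_bigr => i _.
by have := ltn_ord i => lti; rewrite !coef_poly ifT ?gp //; lia.
Qed.

Fact fps_mulA : associative fps_mul.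
Proof.
move=> f g h; apply: fpsP => n.
rewrite (@fps_mul_trunc n.+1 _ _ _ (trunc n.+1 g * trunc n.+1 h)) //; last first.
  by move=> i ltin; rewrite (@coef_fps_mul n.+1).
rewrite fps_mulC (@fps_mul_trunc n.+1 _ _ _ (trunc n.+1 f * trunc n.+1 g)) //.
  by rewrite mulrA mulrC.
by move=> i ltin; rewrite (@coef_fps_mul n.+1).
Qed.

Fact fps_mul1 : left_id fps_one fps_mul.
Proof.
move=> f; apply: fpsP => n; rewrite /fps_mul big_ord_recl mul1r subn0 big1 ?addr0 //.
by move=> i _; rewrite /fps_one /= mul0r.
Qed.

Fact fps_mulDl : left_distributive fps_mul fps_add.
Proof.
move=> f g h; apply: fpsP => n; rewrite /fps_mul /fps_add -big_split /=.
by apply: eq_bigr => i _; rewrite mulrDl.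
Qed.

Fact fps_1_neq0 : fps_one != 0.
Proof. by apply/eqP => /(congr1 (fun f : fps => f 0%N)). Qed.

HB.instance Definition _ := GRing.Zmodule_isComNzRing.Build fps
  fps_mulA fps_mulC fps_mul1 fps_mulDl fps_1_neq0.

Lemma fpsD (f g : fps) n : (f + g) n = f n + g n. Proof. by []. Qed.
Lemma fpsN (f : fps) n : (- f) n = - f n. Proof. by []. Qed.
Lemma fps0 n : (0 : fps) n = 0. Proof. by []. Qed.
Lemma fps1 n : (1 : fps) n = (n == 0%N)%:R. Proof. by []. Qed.
Lemma fpsM (f g : fps) n : (f * g) n = \sum_(i < n.+1) f i * g (n - i)%N.
Proof. by []. Qed.

Lemma fps_sum (I : Type) (r : seq I) (P : pred I) (F : I -> fps) n :
  (\sum_(i <- r | P i) F i) n = \sum_(i <- r | P i) F i n.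
Proof. exact: (big_morph (fun f : fps => f n) (fun f g => fpsD f g n) (fps0 n)). Qed.

(** * Congruence modulo a power of q *)

Definition eqm (N : nat) (f g : fps) := forall n, (n < N)%N -> f n = g n.

Lemma eqm_refl N f : eqm N f f. Proof. by []. Qed.
Lemma eqm_sym N f g : eqm N f g -> eqm N g f.
Proof. by move=> fg n ltn; rewrite fg. Qed.
Lemma eqm_trans N g f h : eqm N f g -> eqm N g h -> eqm N f h.
Proof. by move=> fg gh n ltn; rewrite fg // gh. Qed.
Lemma eqm_le M N f g : (M <= N)%N -> eqm N f g -> eqm M f g.
Proof. by move=> leMN fg n ltn; apply: fg; apply: leq_trans leMN. Qed.
Lemma eqmP f g : (forall N, eqm N f g) -> f = g.
Proof. by move=> fg; apply: fpsP => n; apply: (fg n.+1). Qed.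

Lemma eqmD N f g f' g' : eqm N f f' -> eqm N g g' -> eqm N (f + g) (f' + g').
Proof. by move=> ff gg n ltn; rewrite !fpsD ff // gg. Qed.
Lemma eqmN N f f' : eqm N f f' -> eqm N (- f) (- f').
Proof. by move=> ff n ltn; rewrite !fpsN ff. Qed.
Lemma eqmM N f g f' g' : eqm N f f' -> eqm N g g' -> eqm N (f * g) (f' * g').
Proof.
move=> ff gg n ltn; rewrite !fpsM; apply: eq_bigr => i _.
by have lti := ltn_ord i; rewrite ff ?gg //; lia.
Qed.
Lemma eqm_sum N (I : Type) (r : seq I) (P : pred I) (F G : I -> fps) :
  (forall i, P i -> eqm N (F i) (G i)) ->
  eqm N (\sum_(i <- r | P i) F i) (\sum_(i <- r | P i) G i).
Proof. by move=> FG n ltn; rewrite !fps_sum; apply: eq_bigr => i /FG ->. Qed.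
Lemma eqm_prod N (I : Type) (r : seq I) (P : pred I) (F G : I -> fps) :
  (forall i, P i -> eqm N (F i) (G i)) ->
  eqm N (\prod_(i <- r | P i) F i) (\prod_(i <- r | P i) G i).
Proof. by move=> FG; elim/big_ind2: _ => // *; apply: eqmM. Qed.

(** When u has constant term 1, the coefficients of f can be computed one after
    the other from those of u * f. *)
Lemma eqm_cancel N (u f g : fps) : u 0%N = 1 -> eqm N (u * f) (u * g) -> eqm N f g.
Proof.
move=> u0 ufg n; elim/ltn_ind: n => n IHn ltn.
have := ufg n ltn; rewrite !fpsM !big_ord_recl u0 !mul1r subn0.
rewrite (eq_bigr (fun i : 'I_n => u (lift ord0 i) * g (n - lift ord0 i)%N)).
  exact: addIr.
by move=> i _; have lti := ltn_ord i; rewrite IHn //= /bump /=; lia.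
Qed.

Lemma fps_cancel (u f g : fps) : u 0%N = 1 -> u * f = u * g -> f = g.
Proof. by move=> u0 ufg; apply: eqmP => N; apply: (eqm_cancel u0); rewrite ufg. Qed.

Lemma fpsM0 (f g : fps) : (f * g) 0%N = f 0%N * g 0%N.
Proof. by rewrite fpsM big_ord1. Qed.

Lemma fps_prod0 (I : Type) (r : seq I) (P : pred I) (F : I -> fps) :
  (forall i, P i -> F i 0%N = 1) -> (\prod_(i <- r | P i) F i) 0%N = 1.
Proof. by move=> F1; elim/big_ind: _ => // f g f1 g1; rewrite fpsM0 f1 g1. Qed.

Lemma eqm0M N f g : eqm N f 0 -> eqm N (f * g) 0.
Proof. by move=> f0; rewrite -(mul0r g); apply: eqmM. Qed.

Lemma eqm0Ml N f g : eqm N g 0 -> eqm N (f * g) 0.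
Proof. by rewrite mulrC; apply: eqm0M. Qed.

Lemma eqm0MM M N f g : eqm M f 0 -> eqm N g 0 -> eqm (M + N) (f * g) 0.
Proof.
move=> f0 g0 n ltn; rewrite fpsM big1 // => i _.
have [ltiM | leMi] := ltnP i M; first by rewrite f0 // mul0r.
by rewrite g0 ?mulr0 //; have := ltn_ord i; lia.
Qed.

(** * Monomials *)

(** The exponent is an integer so that quadratic forms in integer variables can
    be used as exponents.  Negative exponents give 0; the products below only
    involve monomials with a nonnegative exponent or a zero coefficient. *)
Definition mon (c e : int) : fps := fun n => if n%:Z == e then c else 0.

Definition q : fps := mon 1 1.

Lemma mon0 e : mon 0 e = 0.
Proof. by apply: fpsP => n; rewrite /mon fps0; case: ifP. Qed.

Lemma monM c d e e' : (c != 0 -> 0 <= e) -> (d != 0 -> 0 <= e') ->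
  mon c e * mon d e' = mon (c * d) (e + e').
Proof.
have [-> | c0 /(_ isT)] := eqVneq c 0; first by rewrite mul0r !mon0 mul0r.
have [-> | d0] := eqVneq d 0; first by rewrite mulr0 !mon0 mulr0.
case: e => // a _ /(_ isT); case: e' => // b _; apply: fpsP => n; rewrite fpsM.
rewrite /mon; case: ifP => [/eqP nab | nab].
  have lta : (a < n.+1)%N by lia.
  rewrite (bigD1 (Ordinal lta)) //= eqxx ifT; last by apply/eqP; lia.
  rewrite big1 ?addr0 // => i /eqP ia; rewrite ifF ?mul0r //.
  by apply/negbTE/eqP => -[?]; apply: ia; apply: val_inj.
rewrite big1 // => i _; have lti := ltn_ord i.
case: eqP => [ia | _]; rewrite ?mul0r // ifF ?mulr0 //.
by apply/negbTE/eqP => nib; move/eqP: nab; lia.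
Qed.

Lemma monD c d e : mon c e + mon d e = mon (c + d) e.
Proof. by apply: fpsP => n; rewrite fpsD /mon; case: ifP; rewrite ?addr0. Qed.

Lemma monN c e : - mon c e = mon (- c) e.
Proof. by apply: fpsP => n; rewrite fpsN /mon; case: ifP; rewrite ?oppr0. Qed.

Lemma mon1 : mon 1 0 = 1.
Proof. by apply: fpsP => n; rewrite fps1 /mon; case: n. Qed.

Lemma qE (n : nat) : q ^+ n = mon 1 n%:Z.
Proof.
elim: n => [|n IHn]; first by rewrite expr0 mon1.
by rewrite exprS IHn monM // mulr1; congr mon; lia.
Qed.

Lemma coef_qn n m : (q ^+ n) m = (m == n)%:R.
Proof. by rewrite qE /mon eqz_nat; case: eqP. Qed.

Lemma eqm_q0 N n : (N <= n)%N -> eqm N (q ^+ n) 0.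
Proof. by move=> leNn m ltm; rewrite coef_qn fps0 (_ : _ == _ = false) //; lia. Qed.

Lemma coef_qnM n f m : (q ^+ n * f) m = if (m < n)%N then 0 else f (m - n)%N.
Proof.
rewrite fpsM; case: ltnP => lemn.
  by rewrite big1 // => i _; have := ltn_ord i; rewrite coef_qn => lti;
     rewrite (_ : _ == _ = false) ?mul0r //; lia.
have ltn : (n < m.+1)%N by lia.
rewrite (bigD1 (Ordinal ltn)) //= coef_qn eqxx mul1r big1 ?addr0 // => i ni.
by rewrite coef_qn (_ : _ == _ = false) ?mul0r //; apply/negbTE.
Qed.

Lemma signM (k : nat) c e : (-1) ^+ k * mon c e = mon ((-1) ^+ k * c) e.
Proof.
by rewrite -signr_odd -[in RHS]signr_odd; case: (odd k); rewrite ?mulN1r ?mul1r ?monN.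
Qed.

Lemma natM_mon (n : nat) c e : n%:R * mon c e = mon (n%:R * c) e.
Proof.
rewrite !mulr_natl; elim: n => [|n IHn]; first by rewrite !mulr0n mon0.
by rewrite !mulrS IHn monD.
Qed.

Definition eps (n : int) : int := (-1) ^+ `|n|%N.

Lemma epsD m n : eps (m + n) = eps m * eps n.
Proof.
rewrite /eps -exprD -[LHS]signr_odd -[RHS]signr_odd; congr (_ ^+ _).
by congr nat_of_bool; lia.
Qed.

Lemma epsN n : eps (- n) = eps n. Proof. by rewrite /eps abszN. Qed.
Lemma eps_even n : eps (2 * n) = 1.
Proof. by rewrite /eps -signr_odd (_ : odd _ = false) //; lia. Qed.
Lemma eps_sq n : eps n * eps n = 1.
Proof. by rewrite -epsD (_ : n + n = 2 * n) ?eps_even //; ring. Qed.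

Lemma eps_Posz (n : nat) : eps n = (-1) ^+ n. Proof. by []. Qed.
Lemma eps_Negz n : eps (Negz n) = (-1) ^+ n.+1. Proof. by []. Qed.

Lemma eps_odd n : odd `|n| -> eps n = -1.
Proof. by move=> n1; rewrite /eps -signr_odd n1. Qed.

Lemma eps_flip m n : odd `|m + n| -> eps m = - eps n.
Proof. by move=> /eps_odd; rewrite epsD => E; rewrite -[LHS]mulr1 -(eps_sq n) mulrA E mulN1r. Qed.

(** * Infinite sums of series *)

(** An exhaustion of the index set by finite boxes.  It allows summability to be
    expressed by an explicit bound, and products of index sets have product
    boxes, which reduces Fubini to finite sums. *)
Class boxed (I : choiceType) := Boxed {
  box : nat -> seq I;
  box_uniq : forall n, uniq (box n);
  box_mono : forall m n i, (m <= n)%N -> i \in box m -> i \in box n;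
  box_exhaust : forall i, exists n, i \in box n }.

#[export] Instance boxed_nat : boxed nat.
Proof.
exists (fun n => iota 0 n.+1) => [n | m n i | i]; first exact: iota_uniq.
  by rewrite !mem_iota; lia.
by exists i; rewrite mem_iota; lia.
Defined.

Lemma mem_box_nat n (i : nat) : (i \in box n) = (i <= n)%N.
Proof. by rewrite mem_iota. Qed.

Definition int_box n := map Posz (iota 0 n.+1) ++ map Negz (iota 0 n).

Lemma mem_int_box n (i : int) : (i \in int_box n) = (`|i| <= n)%N.
Proof.
rewrite mem_cat; case: i => i.
  rewrite mem_map ?mem_iota; last by move=> x y [].
  rewrite (_ : Posz i \in _ = false) ?orbF //.
  by apply/negbTE/mapP => -[].
rewrite [X in _ || X]mem_map ?mem_iota; last by move=> x y [].
rewrite (_ : Negz i \in _ = false) //; apply/negbTE/mapP => -[] //.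
Qed.

#[export] Instance boxed_int : boxed int.
Proof.
exists int_box => [n | m n i | i].
- rewrite cat_uniq !map_inj_uniq ?iota_uniq ?andbT /=; try by move=> x y [].
  by apply/hasPn => _ /mapP[x _ ->]; apply/mapP => -[].
- by rewrite !mem_int_box => lemn /leq_trans; apply.
- by exists `|i|%N; rewrite mem_int_box.
Defined.

Lemma mem_box_int n (i : int) : (i \in box n) = (`|i| <= n)%N.
Proof. exact: mem_int_box. Qed.

#[export] Instance boxed_prod (I J : choiceType) (bI : boxed I) (bJ : boxed J) :
  boxed (I * J)%type.
Proof.
exists (fun n => [seq (i, j) | i <- box n, j <- box n]) => [n | m n p lemn | [i j]].
- by apply: allpairs_uniq; rewrite ?box_uniq // => -[? ?] [].
- move=> /allpairsP[[i j] /= [Ii Jj ->]].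
  by apply/allpairsP; exists (i, j); split=> //; apply: box_mono lemn _.
have [m im] := box_exhaust i; have [n jn] := box_exhaust j.
exists (maxn m n); apply/allpairsP; exists (i, j) => /=; split=> //.
  by apply: box_mono im; rewrite leq_maxl.
by apply: box_mono jn; rewrite leq_maxr.
Defined.

Lemma mem_box_prod (I J : choiceType) (bI : boxed I) (bJ : boxed J) n (p : I * J) :
  (p \in box n) = (p.1 \in box n) && (p.2 \in box n).
Proof.
case: p => i j; apply/allpairsP/andP => /= [[[i' j'] /= [Ii Jj [-> ->]]] // | [Ii Jj]].
by exists (i, j).
Qed.

Lemma box_cover (I : choiceType) (bI : boxed I) (s : seq I) :
  exists n, {subset s <= box n}.
Proof.
elim: s => [|i s [n sn]]; first by exists 0%N.
have [m im] := box_exhaust i; exists (maxn m n) => j; rewrite inE => /orP[/eqP-> | js].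
  by apply: box_mono im; rewrite leq_maxl.
by apply: box_mono (sn j js); rewrite leq_maxr.
Qed.

Definition fsum (I : choiceType) (F : I -> fps) : fps :=
  fun m => \sum_(i \in [set: I]%classic) F i m.

(** For every N only the terms in some box have a nonzero coefficient below N.
    Asking for one box for all coefficients below N, rather than for each
    coefficient, makes products of summable families obviously summable. *)
Definition summable (I : choiceType) (bI : boxed I) (F : I -> fps) :=
  forall N, exists B, forall i m, (m < N)%N -> i \notin box B -> F i m = 0.
Arguments summable {I bI} F.

Lemma fsum_box (I : choiceType) (bI : boxed I) (F : I -> fps) B m :
  (forall i, i \notin box B -> F i m = 0) -> fsum F m = \sum_(i <- box B) F i m.
Proof.
move=> FB; rewrite (@bigfs _ _ _ _ (box B) xpredT) ?box_uniq //; last by move=> i _ /FB.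
by apply: eq_fsbigl; apply/seteqP; split.
Qed.

Lemma summable_box (I : choiceType) (bI : boxed I) (F : I -> fps) m : summable F ->
  exists B, (forall i, i \notin box B -> F i m = 0) /\
            forall B', (B <= B')%N -> fsum F m = \sum_(i <- box B') F i m.
Proof.
move=> /(_ m.+1)[B FB]; exists B; split=> [i iB | B' leB]; first exact: FB.
by apply: fsum_box => i iB'; apply: FB => //; apply: contra iB' => /box_mono; apply.
Qed.

Section Fsum.
Variables (I : choiceType) (bI : boxed I).
Implicit Types F G : I -> fps.

Lemma eq_fsum F G : F =1 G -> fsum F = fsum G.
Proof. by move=> FG; apply: fpsP => m; apply: eq_fsbigr => i _; rewrite FG. Qed.

Lemma fsum_eq0 F : (forall i, F i = 0) -> fsum F = 0.
Proof. by move=> F0; apply: fpsP => m; apply: fsbig1 => i _; rewrite F0. Qed.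

Lemma summable_sub F G : (forall i m, F i m = 0 -> G i m = 0) ->
  summable F -> summable G.
Proof. by move=> FG sF N; have [B FB] := sF N; exists B => i m /FB Fi /Fi /FG. Qed.

Lemma eq_summable F G : F =1 G -> summable F -> summable G.
Proof. by move=> FG; apply: summable_sub => i m; rewrite FG. Qed.

Lemma summableD F G : summable F -> summable G -> summable (fun i => F i + G i).
Proof.
move=> sF sG N; have [B FB] := sF N; have [C GC] := sG N; exists (maxn B C) => i m mN iBC.
rewrite fpsD FB ?GC //; apply: contra iBC => /box_mono; apply.
  by rewrite leq_maxr.
by rewrite leq_maxl.
Qed.

Lemma summableN F : summable F -> summable (fun i => - F i).
Proof. by apply: summable_sub => i m; rewrite fpsN => ->; rewrite oppr0. Qed.

Lemma summableMl c F : summable F -> summable (fun i => c * F i).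
Proof.
move=> sF N; have [B FB] := sF N; exists B => i m mN iB; rewrite fpsM big1 // => k _.
by rewrite FB ?mulr0 //; have := ltn_ord k; lia.
Qed.

Lemma fsumD F G : summable F -> summable G ->
  fsum (fun i => F i + G i) = fsum F + fsum G.
Proof.
move=> sF sG; apply: fpsP => m; rewrite fpsD.
have [B [FB FE]] := summable_box m sF; have [C [GC GE]] := summable_box m sG.
have [D [_ DE]] := summable_box m (summableD sF sG).
pose M := maxn D (maxn B C).
rewrite (DE M) ?(FE M) ?(GE M) ?leq_max ?leqnn ?orbT //.
by rewrite -big_split.
Qed.

Lemma fsumN F : fsum (fun i => - F i) = - fsum F.
Proof.
apply: fpsP => m; rewrite fpsN -mulN1r mulr_fsumr; apply: eq_fsbigr => i _.
by rewrite mulN1r.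
Qed.

Lemma fsumB F G : summable F -> summable G ->
  fsum (fun i => F i - G i) = fsum F - fsum G.
Proof. by move=> sF sG; rewrite fsumD ?fsumN //; apply: summableN. Qed.

Lemma fsumMl c F : summable F -> fsum (fun i => c * F i) = c * fsum F.
Proof.
move=> sF; apply: fpsP => m.
have [B FB] := sF m.+1.
rewrite (@fsum_box _ _ _ B); last first.
  move=> i iB; rewrite fpsM big1 // => k _; rewrite FB ?mulr0 //.
  by have := ltn_ord k; lia.
rewrite fpsM; under eq_bigr do rewrite fpsM.
rewrite exchange_big; apply: eq_bigr => k _; rewrite (@fsum_box _ _ _ B).
  by rewrite mulr_sumr.
by move=> i iB; apply: FB => //; have := ltn_ord k; lia.
Qed.

Lemma fsum1 i0 F : (forall i, i != i0 -> F i = 0) -> fsum F = F i0.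
Proof.
move=> F0; apply: fpsP => m; rewrite /fsum -(fsbig_widen [set i0]%classic) //.
  by rewrite fsbig_set1.
by move=> i [_ /= /eqP ii]; rewrite F0.
Qed.

End Fsum.

(** The map h only has to reach the indices of the nonzero terms, so a sum may be
    restricted to a sublattice on which it is supported. *)
Lemma fsum_reindex (I J : choiceType) (h : J -> I) (h' : I -> J) (F : I -> fps) :
    cancel h h' -> (forall i, F i != 0 -> h (h' i) = i) ->
  fsum F = fsum (fun j => F (h j)).
Proof.
move=> hK FK; apply: fpsP => m; rewrite /fsum.
rewrite -(fsbig_widen [set h j | j in [set: J]%classic]%classic) //; last first.
  move=> i [_ /= nhi]; apply: contra_notP nhi => Fi; exists (h' i) => //.
  by apply: FK; apply/eqP => F0; apply: Fi; rewrite F0.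
by rewrite fsbig_image // => j k _ _ /(can_inj hK).
Qed.

Lemma summable_inj (I J : choiceType) (bI : boxed I) (bJ : boxed J)
    (h : J -> I) (h' : I -> J) (F : I -> fps) :
  cancel h h' -> summable F -> summable (fun j => F (h j)).
Proof.
move=> hK sF N; have [B FB] := sF N.
have [C BC] := box_cover bJ (map h' (box B)).
exists C => j m mN jC; apply: FB => //; apply: contra jC => hjB.
by apply: BC; apply/mapP; exists (h j); rewrite ?hK.
Qed.

(** Reindexing by h shows that the sum is its own opposite. *)
Lemma fsum_invol (I : choiceType) (h : I -> I) (F : I -> fps) :
  involutive h -> (forall i, F (h i) = - F i) -> fsum F = 0.
Proof.
move=> hK Fh; have FE : fsum F = - fsum F.
  rewrite {1}(@fsum_reindex _ _ h h) // -fsumN; exact: eq_fsum.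
apply: fpsP => m; have := congr1 (fun f : fps => f m) FE; rewrite fpsN fps0; lia.
Qed.

Section FsumPair.
Variables (I J : choiceType) (bI : boxed I) (bJ : boxed J).

Lemma summable_fsum (F : I * J -> fps) : summable F ->
  summable (fun i => fsum (fun j => F (i, j))).
Proof.
move=> sF N; have [B FB] := sF N; exists B => i m mN iB; apply: fsbig1 => j _.
by apply: FB; rewrite ?mem_box_prod //= negb_and iB.
Qed.

Lemma fsum_pair (F : I * J -> fps) : summable F ->
  fsum F = fsum (fun i => fsum (fun j => F (i, j))).
Proof.
move=> sF; apply: fpsP => m; have [B FB] := sF m.+1.
rewrite (@fsum_box _ _ _ B); last by move=> i; apply: FB.
rewrite big_allpairs (@fsum_box _ _ _ B); last first.
  by move=> i iB; apply: fsbig1 => j _; apply: FB; rewrite ?mem_box_prod //= negb_and iB.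
apply: eq_bigr => i _; rewrite (@fsum_box _ _ _ B) // => j jB.
by apply: FB; rewrite ?mem_box_prod //= negb_and jB orbT.
Qed.

Lemma summableM (F : I -> fps) (G : J -> fps) : summable F -> summable G ->
  summable (fun p : I * J => F p.1 * G p.2).
Proof.
move=> sF sG N; have [B FB] := sF N; have [C GC] := sG N; exists (maxn B C) => -[i j] m mN.
rewrite mem_box_prod negb_and /= => ijBC; rewrite fpsM big1 // => k _.
have ltk := ltn_ord k; case/orP: ijBC => [iB | jC].
  rewrite FB ?mul0r //; first by lia.
  by apply: contra iB; apply: box_mono; rewrite leq_maxl.
rewrite GC ?mulr0 //; first by lia.
by apply: contra jC; apply: box_mono; rewrite leq_maxr.
Qed.

Lemma fsumM (F : I -> fps) (G : J -> fps) : summable F -> summable G ->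
  fsum F * fsum G = fsum (fun p : I * J => F p.1 * G p.2).
Proof.
move=> sF sG; rewrite fsum_pair; last exact: summableM.
rewrite mulrC -fsumMl //; apply: eq_fsum => i; rewrite mulrC -fsumMl //.
Qed.

End FsumPair.

Lemma fsum_swap (I J : choiceType) (F : I * J -> fps) :
  fsum F = fsum (fun p : J * I => F (p.2, p.1)).
Proof. by apply: (@fsum_reindex _ _ _ (fun p => (p.2, p.1))) => [[] | []]. Qed.

(** * Sums over the natural numbers and over the integers *)

Lemma summable_nat (F : nat -> fps) :
  (forall n m, (m < n)%N -> F n m = 0) -> summable F.
Proof. by move=> F0 N; exists N => n m mN; rewrite mem_box_nat => nN; apply: F0; lia. Qed.

Lemma summable_mon (I : choiceType) (bI : boxed I) (s e : I -> int) :
  (forall N : nat, exists B, forall i, s i != 0 -> e i < N%:Z -> i \in box B) ->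
  summable (fun i => mon (s i) (e i)).
Proof.
move=> sB N; have [B iB] := sB N; exists B => i m ltm iNB; rewrite /mon.
case: eqP => // me; apply/eqP; apply: contraNT iNB => si0.
by apply: iB => //; rewrite -me ltz_nat.
Qed.

Lemma summable_eqm (F : nat -> fps) : (forall n, eqm n (F n) 0) -> summable F.
Proof. by move=> F0; apply: summable_nat => n m ltmn; rewrite F0. Qed.

Lemma fsum_recl (F : nat -> fps) : summable F ->
  fsum F = F 0%N + fsum (fun n => F n.+1).
Proof.
move=> sF; pose F0 n := if n is 0%N then F 0%N else 0.
pose F1 n := if n is 0%N then 0 else F n.
rewrite (@eq_fsum _ _ (fun n => F0 n + F1 n)); last first.
  by case=> [|n]; rewrite ?addr0 ?add0r.
rewrite fsumD; first congr (_ + _).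
- by rewrite (@fsum1 _ 0%N) //; case.
- by rewrite (@fsum_reindex _ _ succn predn) //; case => //; rewrite eqxx.
- by apply: summable_sub sF => -[].
- by apply: summable_sub sF => -[].
Qed.

Lemma fsum_telescope (F : nat -> fps) : summable F ->
  fsum (fun n => F n.+1 - F n) = - F 0%N.
Proof.
move=> sF; rewrite fsumB //; last exact: (@summable_inj _ _ _ _ succn predn).
by rewrite (fsum_recl sF) opprD addrCA subrr addr0.
Qed.

Lemma fsum_int (F : int -> fps) : summable F ->
  fsum F = fsum (fun n => F (Posz n)) + fsum (fun n => F (Negz n)).
Proof.
move=> sF; pose F0 n := if n is Posz _ then F n else 0.
pose F1 n := if n is Posz _ then 0 else F n.
rewrite (@eq_fsum _ _ (fun n => F0 n + F1 n)); last first.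
  by case=> n; rewrite ?addr0 ?add0r.
rewrite fsumD; first congr (_ + _).
- rewrite (@fsum_reindex _ _ Posz (fun n => `|n|%N)) //; case => // n.
  by rewrite eqxx.
- rewrite (@fsum_reindex _ _ Negz (fun n => `|n|%N.-1)) //; case => // n.
  by rewrite eqxx.
- by apply: summable_sub sF => -[].
- by apply: summable_sub sF => -[].
Qed.

(** Summation over the diagonals n = m + j of the quadrant. *)
Lemma fsum_diag (F : nat -> nat -> fps) :
    summable (fun p : nat * nat => F p.1 p.2) ->
  fsum (fun n => \sum_(j < n.+1) F (n - j)%N j) = fsum (fun p : nat * nat => F p.1 p.2).
Proof.
move=> sF.
pose G (p : nat * nat) : fps := if (p.2 <= p.1)%N then F (p.1 - p.2)%N p.2 else 0.
pose h (p : nat * nat) : nat * nat := (p.1 + p.2, p.2)%N.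
pose h' (p : nat * nat) : nat * nat := (p.1 - p.2, p.2)%N.
have hK : cancel h h' by case=> i j; rewrite /h /h' /= addnK.
have GE p : G (h p) = F p.1 p.2 by rewrite /G /= leq_addl addnK.
have sG : summable G.
  move=> N; have [B FB] := sF N; exists (B + B)%N => -[n j] m mN.
  rewrite mem_box_prod !mem_box_nat /G /= => nj; case: leqP => // jn.
  by apply: (FB (_, _)) => //; rewrite mem_box_prod !mem_box_nat /=; lia.
rewrite -(eq_fsum GE) -(@fsum_reindex _ _ h h' G) //; last first.
  case=> n j; rewrite /G /h /h' /=; case: leqP => [jn _|]; last by rewrite eqxx.
  by rewrite subnK.
rewrite fsum_pair //; apply: eq_fsum => n; apply: fpsP => m.
rewrite fps_sum /fsum (fsbig_ord _ _ (fun j => F (n - j)%N j m)).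
under [RHS]eq_fsbigr do rewrite /G /=.
rewrite -[RHS](fsbig_widen `I_n.+1%classic) //; last first.
  by move=> j [_ /= /negP]; rewrite ltnS /G /= => /negbTE ->.
apply: eq_fsbigr => j; rewrite inE /= ltnS => ->; by [].
Qed.

(** The pairs (a, b) with a + b even are exactly the pairs (c + d, c - d); the
    others are cancelled by the exchange of a and b. *)
Lemma fsum_halve (F : int * int -> fps) : summable F ->
    (forall a b, odd `|a + b| -> F (b, a) = - F (a, b)) ->
  fsum F = fsum (fun p => F (p.1 + p.2, p.1 - p.2)).
Proof.
move=> sF Fodd.
pose F0 p := if odd `|p.1 + p.2| then 0 else F p.
pose F1 p := if odd `|p.1 + p.2| then F p else 0.
have sF0 : summable F0 by apply: summable_sub sF => p m; rewrite /F0; case: ifP.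
have sF1 : summable F1 by apply: summable_sub sF => p m; rewrite /F1; case: ifP.
rewrite (@eq_fsum _ _ (fun p => F0 p + F1 p)); last first.
  by move=> p; rewrite /F0 /F1; case: ifP; rewrite ?addr0 ?add0r.
rewrite fsumD // [fsum F1](@fsum_invol _ (fun p => (p.2, p.1))); last first.
- by case=> a b; rewrite /F1 /= addrC; case: ifP => [/Fodd // | _]; rewrite oppr0.
- by case.
pose h (p : int * int) := (p.1 + p.2, p.1 - p.2).
pose h' (p : int * int) := (((p.1 + p.2) %/ 2)%Z, ((p.1 - p.2) %/ 2)%Z).
rewrite addr0 (@fsum_reindex _ _ h h' F0).
- by apply: eq_fsum => -[c d]; rewrite /F0 /h /= ifF //; apply/negbTE; lia.
- by case=> c d; rewrite /h /h' /=; congr pair; lia.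
case=> a b; rewrite /F0 /h /h' /=; case: ifP => [_ | ev _]; first by rewrite eqxx.
by congr pair; lia.
Qed.

(** * Gaussian binomials and a finite triple product identity *)

Section QBinomial.
Variables (R : comNzRingType) (x : R).

Fixpoint qbin (n k : nat) : R :=
  match n, k with
  | _, 0%N => 1
  | 0%N, _.+1 => 0
  | n.+1, k.+1 => qbin n k + x ^+ k.+1 * qbin n k.+1
  end.

Arguments qbin : simpl never.

Definition qfac n : R := \prod_(i < n) (1 - x ^+ i.+1).

Lemma qbin0 n : qbin n 0 = 1. Proof. by case: n. Qed.

Lemma qbinS n k : qbin n.+1 k.+1 = qbin n k + x ^+ k.+1 * qbin n k.+1.
Proof. by []. Qed.

Lemma qbin_small n k : (n < k)%N -> qbin n k = 0.
Proof.
by elim: n k => [|n IHn] [|k] // ltnk; rewrite qbinS !IHn ?mulr0 ?addr0 //; lia.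
Qed.

(** Both sides are the quotient of the product of the k + 1 top factors
    1 - x ^ n, ..., 1 - x ^ (n - k) by the first k factors 1 - x ^ i; stated
    without division, so that it holds in every commutative ring. *)
Lemma qbin_step n k : (k <= n)%N ->
  (1 - x ^+ k.+1) * qbin n k.+1 = (1 - x ^+ (n - k)) * qbin n k.
Proof.
elim: n k => [|n IHn] k; first by case: k => // _; rewrite qbin_small // sub0n expr0; ring.
rewrite leq_eqVlt => /orP[/eqP-> | ltkn].
  by rewrite subnn expr0 qbin_small //; ring.
have xE : x ^+ n.+1 = x ^+ k.+1 * x ^+ (n - k) by rewrite -exprD; congr (_ ^+ _); lia.
rewrite qbinS mulrDr mulrCA IHn //; case: k ltkn xE => [|k] ltkn xE.
  by rewrite !qbin0 !subn0 in xE *; rewrite xE; ring.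
have {}IHn := IHn k (ltnW ltkn).
rewrite qbinS subSS [RHS]mulrDr -IHn.
have -> : (n - k = (n - k.+1).+1)%N by lia.
by rewrite !exprS; ring.
Qed.

Lemma qbin_pascal n k : (k <= n)%N ->
  qbin n.+1 k.+1 = x ^+ (n - k) * qbin n k + qbin n k.+1.
Proof. move=> lekn; rewrite qbinS; have := qbin_step lekn.
by rewrite !mulrBl !mul1r => /eqP; rewrite subr_eq addrAC eq_sym subr_eq => /eqP ->; rewrite addrC.
Qed.

Lemma qbin_absorb n k : (1 - x ^+ k.+1) * qbin n.+1 k.+1 = (1 - x ^+ n.+1) * qbin n k.
Proof.
have [lekn | ltnk] := leqP k n; last by rewrite !qbin_small ?mulr0 //; lia.
rewrite qbinS mulrDr mulrCA qbin_step //.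
have -> : x ^+ n.+1 = x ^+ k.+1 * x ^+ (n - k) by rewrite -exprD; congr (_ ^+ _); lia.
ring.
Qed.

Lemma qbin_up n k : (k <= n.+1)%N ->
  (1 - x ^+ (n.+1 - k)) * qbin n.+1 k = (1 - x ^+ n.+1) * qbin n k.
Proof.
case: k => [|k] lekn; first by rewrite !qbin0 subn0.
have lekn' : (k <= n)%N by lia.
rewrite subSS qbinS mulrDr -qbin_step //.
have -> : x ^+ n.+1 = x ^+ k.+1 * x ^+ (n - k) by rewrite -exprD; congr (_ ^+ _); lia.
ring.
Qed.

Lemma qbinn n : qbin n n = 1.
Proof. by elim: n => // n IHn; rewrite qbinS IHn qbin_small ?mulr0 ?addr0. Qed.

Lemma qbin_sym k l : qbin (k + l) k = qbin (k + l) l.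
Proof.
elim: k l => [|k IHk] l.
  by rewrite add0n qbin0 qbinn.
elim: l => [|l IHl]; first by rewrite addn0 qbin0 qbinn.
rewrite addnS qbinS (@qbin_pascal _ l); last by lia.
have -> : (k.+1 + l - l = k.+1)%N by lia.
by rewrite IHl addSnnS IHk addrC.
Qed.

Lemma qfacS n : qfac n.+1 = qfac n * (1 - x ^+ n.+1).
Proof. exact: big_ord_recr. Qed.

Lemma qbin_qfac k l : qbin (k + l) k * (qfac k * qfac l) = qfac (k + l).
Proof.
elim: k => [|k IHk]; first by rewrite qbin0 /qfac big_ord0 !mul1r.
rewrite addSn !qfacS -IHk; have := qbin_absorb (k + l) k.
set A := qbin _.+1 _ => E.
by transitivity ((1 - x ^+ k.+1) * A * (qfac k * qfac l)); [ring | rewrite E; ring].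
Qed.

(** Two steps of the Pascal recurrence, combined symmetrically. *)
Lemma qbin_step2 n k : (k <= n)%N ->
  qbin n.+2 k.+2 =
  (1 + x ^+ n.+1) * qbin n k.+1 + x ^+ k.+2 * qbin n k.+2 + x ^+ (n - k) * qbin n k.
Proof.
rewrite leq_eqVlt => /orP[/eqP-> | ltkn].
  by rewrite subnn expr0 !qbinn (@qbin_small n n.+1) // (@qbin_small n n.+2) //; ring.
rewrite qbinS (@qbin_pascal n k) ?(@qbin_pascal n k.+1) //; last by lia.
have -> : x ^+ n.+1 = x ^+ k.+2 * x ^+ (n - k.+1) by rewrite -exprD; congr (_ ^+ _); lia.
ring.
Qed.

(** The coefficients of the finite triple product, extended by 0 beyond k = n
    (where the truncated subtraction would give 1), so that their recurrence
    holds without exception. *)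
Definition jbin n k := if (k <= n)%N then qbin n.*2.+1 (n - k) else 0.

(** The recurrence of [jbinS] at k = - 1, by the symmetry of the coefficients
    under k -> - k - 1. *)
Lemma jbin0 n :
  jbin n.+1 0 = (1 + x ^+ n.*2.+2 + x ^+ n.+1) * jbin n 0 + x ^+ n.+2 * jbin n 1.
Proof.
rewrite /jbin /= !subn0; case: n => [|n] /=.
  rewrite -[1.*2.+1]/3%N -[0.*2.+1]/1%N -[0.*2.+2]/2%N !qbinS !qbin0 !qbin_small //; ring.
have symE : qbin n.+1.*2.+1 n.+2 = qbin n.+1.*2.+1 n.+1.
  by have := qbin_sym n.+1 n.+2; rewrite addnS addnn.
rewrite doubleS (@qbin_step2 _ n); last by lia.
rewrite symE subn1 /=; have -> : (n.+1.*2.+1 - n = n.+3)%N by lia.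
ring.
Qed.

Lemma jbinS n k :
  jbin n.+1 k.+1 = (1 + x ^+ n.*2.+2) * jbin n k.+1 + x ^+ (n - k) * jbin n k
                   + x ^+ (n + k + 3) * jbin n k.+2.
Proof.
rewrite /jbin ltnS subSS; case: (leqP k n) => [lekn | ltnk]; last first.
  by rewrite !ifF ?mulr0 ?addr0 //; apply/negbTE; rewrite -leqNgt; lia.
have [l nE] : exists l, n = (k + l)%N by exists (n - k)%N; lia.
have -> : (n - k = l)%N by lia.
case: l nE => [|[|l]] nE.
- rewrite !ifF ?qbin0 ?expr0; [|apply/negbTE; lia..].
  ring.
- rewrite ifT ?ifF; [|apply/negbTE; lia | lia].
  have -> : (n - k.+1 = 0)%N by lia.
  have -> : (n.+1.*2.+1 = n.*2.+3)%N by lia.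
  rewrite qbinS qbin_pascal // !qbin0 subn0.
  by rewrite expr1 (exprS _ n.*2.+1); ring.
rewrite !ifT; [|lia..].
have -> : (n - k.+1 = l.+1)%N by lia.
have -> : (n - k.+2 = l)%N by lia.
rewrite doubleS qbin_step2; last by lia.
have -> : (n.*2.+1 - l = n + k + 3)%N by lia.
ring.
Qed.

(** For c = x (z + 1/z) the sequence is
      u k = x ^ (k (k + 1) / 2) (z ^ (- k) + ... + z ^ k),
    the k-th factor on the left is (1 - z x ^ (k + 1)) (1 - x ^ (k + 1) / z), and
    the identity is the finite triple product divided by its factor 1 - z.  The
    form with c and u avoids negative powers and covers z = 1, where it becomes
    Jacobi's identity for cubes in the limit.  The proof is by induction on n:
    multiplication by the new factor acts on the sequence u by its recurrence,
    and on the coefficients by two steps of the Pascal rule. *)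
Lemma finite_triple_product (c : R) (u : nat -> R) n :
    u 0%N = 1 -> u 1%N = c + x ->
    (forall k, u k.+2 = c * x ^+ k.+1 * u k.+1 - x ^+ (2 * k + 3) * u k) ->
  \prod_(k < n) (1 - c * x ^+ k + x ^+ (2 * k + 2)) =
  \sum_(k < n.+1) (-1) ^+ k * qbin n.*2.+1 (n - k) * u k.
Proof.
move=> u0 u1 uS.
pose S n N := \sum_(k < N) (-1) ^+ k * jbin n k * u k.
have SE m : S m m.+1 = \sum_(k < m.+1) (-1) ^+ k * qbin m.*2.+1 (m - k) * u k.
  by apply: eq_bigr => k _; rewrite /jbin -ltnS ltn_ord.
have S_widen m N : (m < N)%N -> S m N = S m m.+1.
  elim: N => // N IHN; rewrite ltnS leq_eqVlt => /orP[/eqP-> // | ltmN].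
  rewrite /S big_ord_recr /= -/(S m N) IHN // /jbin ifF ?mulr0 ?mul0r ?addr0 //.
  by apply/negbTE; lia.
rewrite -SE; elim: n => [|n IHn]; first by rewrite /S big_ord0 big_ord1 /jbin u0 /= qbin0 expr0; ring.
rewrite big_ord_recr /= IHn -[S n n.+1](@S_widen n n.+3); last by lia.
rewrite -(@S_widen n.+1 n.+3); last by lia.
have jbin_big m k : (m < k)%N -> jbin m k = 0 by rewrite ltnNge /jbin => /negbTE ->.
(* D k is c x^n times the k-th term of the sum, rewritten by the recurrence of u;
   the last summand at k = 0 stands for the term in u (- 1), which is - 1. *)
pose D k := (-1) ^+ k * x ^+ (n - k) * jbin n k * u k.+1
  + (if k is k'.+1 then (-1) ^+ k * x ^+ (n + k'.+2) * jbin n k * u k'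
     else - x ^+ n.+1 * jbin n 0).
have DE k : c * x ^+ n * ((-1) ^+ k * jbin n k * u k) = D k.
  rewrite /D; case: (leqP k n) => [lekn | ltnk]; last first.
    by rewrite jbin_big //; case: k ltnk => // k _; ring.
  have -> : x ^+ n = x ^+ (n - k) * x ^+ k by rewrite -exprD; congr (_ ^+ _); lia.
  case: k lekn => [|k] lekn.
    rewrite u0 u1 subn0 expr0 exprSr; ring.
  have -> : x ^+ (n + k.+2) = x ^+ (n - k.+1) * x ^+ (2 * k + 3).
    by rewrite -exprD; congr (_ ^+ _); lia.
  rewrite uS; ring.
have -> : S n n.+3 * (1 - c * x ^+ n + x ^+ (2 * n + 2)) =
    (1 + x ^+ n.*2.+2) * S n n.+3 - \sum_(k < n.+3) D k.
  under [X in _ = _ - X]eq_bigr do rewrite -DE.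
  rewrite -mulr_sumr -/(S n n.+3).
  have -> : (2 * n + 2 = n.*2.+2)%N by lia.
  ring.
have -> : \sum_(k < n.+3) D k =
    - \sum_(k < n.+2) (-1) ^+ k.+1 * x ^+ (n - k) * jbin n k * u k.+1
    - \sum_(k < n.+3) (-1) ^+ k * x ^+ (n + k + 2) * jbin n k.+1 * u k
    - x ^+ n.+1 * jbin n 0.
  rewrite big_split /= [X in X + _]big_ord_recr /= (@jbin_big n n.+2); last by lia.
  rewrite [X in _ + X]big_ord_recl [X in _ = _ - X - _]big_ord_recr /=.
  rewrite (@jbin_big n n.+3); last by lia.
  have -> : \sum_(i < n.+2) (-1) ^+ bump 0 i * x ^+ (n + (0 + i).+2) *
      jbin n (bump 0 i) * u (0 + i)%N =
      - \sum_(i < n.+2) (-1) ^+ i * x ^+ (n + i + 2) * jbin n i.+1 * u i.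
    rewrite -sumrN; apply: eq_bigr => k _; rewrite /bump /= add1n.
    have -> : (n + (0 + k).+2 = n + k + 2)%N by lia.
    by rewrite exprS; ring.
  have -> : \sum_(i < n.+2) (-1) ^+ i * x ^+ (n - i) * jbin n i * u i.+1 =
      - \sum_(i < n.+2) (-1) ^+ i.+1 * x ^+ (n - i) * jbin n i * u i.+1.
    by rewrite -sumrN; apply: eq_bigr => k _; rewrite exprS; ring.
  ring.
rewrite opprB !opprD !opprK /S !(big_ord_recl n.+2) /= mulrDr mulr_sumr.
rewrite u0 expr0 jbin0 addn0.
rewrite [in RHS](eq_bigr (fun k : 'I_n.+2 =>
   (1 + x ^+ n.*2.+2) * ((-1) ^+ k.+1 * jbin n k.+1 * u k.+1)
   + (-1) ^+ k.+1 * x ^+ (n - k) * jbin n k * u k.+1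
   + (-1) ^+ k.+1 * x ^+ (n + k.+1 + 2) * jbin n k.+2 * u k.+1)); last first.
  move=> k _; rewrite /bump /= add1n jbinS.
  have -> : (n + k.+1 + 2 = n + k + 3)%N by lia.
  ring.
rewrite !big_split /=.
have -> : (n + 2 = n.+2)%N by lia.
set A := \sum_(i < n.+2) _; set B := \sum_(i < n.+2) _; set C := \sum_(i < n.+2) _.
ring.
Qed.

End QBinomial.
Arguments qbin : simpl never.

(** * Infinite products *)

Definition unital (F : nat -> fps) := forall k, eqm k.+1 (F k) 1.

Definition pinf (F : nat -> fps) : fps := fun m => (\prod_(k < m.+1) F k) m.

Lemma eqm_pinf F N M : unital F -> (N <= M)%N -> eqm N (pinf F) (\prod_(k < M) F k).
Proof.
move=> F1 leNM m ltm; rewrite /pinf.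
have -> : M = (m.+1 + (M - m.+1))%N by lia.
elim: (M - m.+1)%N => [|d IHd]; first by rewrite addn0.
rewrite addnS [X in _ = X m]big_ord_recr /=; apply: etrans IHd _.
rewrite -[X in X m = _]mulr1.
by apply: (@eqmM m.+1 _ _ _ _ (@eqm_refl _ _)) => // k ltk; rewrite F1 //; lia.
Qed.

(** A sharper truncation for factors that are close to 1 sooner than [unital]
    requires. *)
Lemma eqm_pinf_tail F N M : unital F -> (forall k, (M <= k)%N -> eqm N (F k) 1) ->
  eqm N (pinf F) (\prod_(k < M) F k).
Proof.
move=> F1 FM; apply: eqm_trans (eqm_pinf F1 (leq_addl M N)) _.
suff tail d : eqm N (\prod_(k < M + d) F k) (\prod_(k < M) F k) by [].
elim: d => [|d IHd]; first by rewrite addn0.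
rewrite addnS big_ord_recr /= -[X in eqm _ _ X]mulr1.
by apply: eqmM => //; apply: FM; rewrite leq_addr.
Qed.

Lemma unitalM F G : unital F -> unital G -> unital (fun k => F k * G k).
Proof. by move=> F1 G1 k; rewrite -[1]mulr1; apply: eqmM. Qed.

Lemma unital_sub F (h : nat -> nat) : (forall k, (k <= h k)%N) -> unital F ->
  unital (F \o h).
Proof. by move=> leh F1 k; apply: (@eqm_le _ (h k).+1); [apply: leh | apply: F1]. Qed.

Lemma eq_pinf F G : F =1 G -> pinf F = pinf G.
Proof. by move=> FG; apply: fpsP => m; rewrite /pinf; congr (_ m); apply: eq_bigr. Qed.

Lemma pinfM F G : unital F -> unital G -> pinf (fun k => F k * G k) = pinf F * pinf G.
Proof.
move=> F1 G1; apply: eqmP => N; apply: eqm_trans.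
  exact: (eqm_pinf (unitalM F1 G1) (leqnn N)).
by rewrite big_split; apply: eqmM; apply/eqm_sym/eqm_pinf.
Qed.

Lemma pinf0 F : unital F -> pinf F 0%N = 1.
Proof. by move=> F1; rewrite /pinf big_ord1 F1. Qed.

Lemma pinf_recl F : unital F -> pinf F = F 0%N * pinf (F \o succn).
Proof.
move=> F1; apply: eqmP => N; apply: eqm_trans (eqm_pinf F1 (leqnSn N)) _.
rewrite big_ord_recl; apply: eqmM => //; apply/eqm_sym/eqm_pinf => //.
by apply: unital_sub => // k; apply: leqnSn.
Qed.

(** The factors are grouped according to their index modulo d. *)
Lemma pinf_residues d F : (0 < d)%N -> unital F ->
  pinf F = \prod_(r < d) pinf (fun k => F (d * k + r)%N).
Proof.
move=> d_gt0 F1; apply: eqmP => N.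
apply: (@eqm_trans _ (\prod_(k < d * N) F k)).
  by apply: eqm_pinf => //; rewrite leq_pmull.
apply: (@eqm_trans _ (\prod_(r < d) \prod_(k < N) F (d * k + r)%N)); last first.
  apply: eqm_prod => r _; apply/eqm_sym/eqm_pinf => //.
  apply: (@unital_sub F (fun k => d * k + r)%N) => // k.
  by apply: leq_trans (leq_addr _ _); rewrite leq_pmull.
have -> // : \prod_(k < d * N) F k = \prod_(r < d) \prod_(k < N) F (d * k + r)%N.
rewrite exchange_big /=; elim: N => [|N IHN]; first by rewrite muln0 !big_ord0.
rewrite big_ord_recr /= -IHN mulnS addnC -(big_mkord xpredT F) (@big_cat_nat _ _ _ (d * N)) //=.
  rewrite big_mkord; congr (_ * _); rewrite -{1}[(d * N)%N]add0n big_addn.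
  by rewrite addKn big_mkord; apply: eq_bigr => i _; rewrite addnC.
exact: leq_addr.
Qed.

(** The products (q ^ b; q ^ a)_oo. *)
Definition pr a b : fps := pinf (fun k => 1 - q ^+ (a * k + b)).

Lemma unital_pr a b : (0 < a)%N -> (0 < b)%N -> unital (fun k => 1 - q ^+ (a * k + b)).
Proof.
move=> a0 b0 k; rewrite -[X in eqm _ _ X]subr0; apply: eqmD => //; apply: eqmN.
by apply: eqm_q0; have := leq_pmull k a0; lia.
Qed.

Lemma unital_prN a b : (0 < a)%N -> (0 < b)%N -> unital (fun k => 1 + q ^+ (a * k + b)).
Proof.
move=> a0 b0 k; rewrite -[X in eqm _ _ X]addr0; apply: eqmD => //.
by apply: eqm_q0; have := leq_pmull k a0; lia.
Qed.

Lemma pr0 a b : (0 < a)%N -> (0 < b)%N -> pr a b 0%N = 1.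
Proof. by move=> a0 b0; apply/pinf0/unital_pr. Qed.

Lemma pr_recl a b : (0 < a)%N -> (0 < b)%N -> pr a b = (1 - q ^+ b) * pr a (a + b).
Proof.
move=> a0 b0; rewrite /pr pinf_recl; last exact: unital_pr.
by rewrite muln0; congr (_ * _); apply: eq_pinf => k /=; congr (1 - q ^+ _); lia.
Qed.

Lemma pr_residues d a b : (0 < d)%N -> (0 < a)%N -> (0 < b)%N ->
  pr a b = \prod_(r < d) pr (d * a) (a * r + b).
Proof.
move=> d0 a0 b0; rewrite /pr (pinf_residues d0); last exact: unital_pr.
apply: eq_bigr => r _; apply: eq_pinf => k; congr (1 - q ^+ _).
by rewrite mulnDr mulnA [(a * d)%N]mulnC addnA.
Qed.

Lemma eqm_qfac a N M : (0 < a)%N -> (N <= M)%N -> eqm N (qfac (q ^+ a) M) (pr a a).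
Proof.
move=> a0 leNM; apply: eqm_sym; rewrite /qfac.
have -> : \prod_(i < M) (1 - (q ^+ a) ^+ i.+1) = \prod_(i < M) (1 - q ^+ (a * i + a)).
  by apply: eq_bigr => i _; rewrite -exprM mulnS addnC.
by apply: eqm_pinf => //; apply: unital_pr.
Qed.

(** The Gaussian binomials of large arguments tend to 1 / (q ^ a; q ^ a)_oo. *)
Lemma eqm_qbin a N k l : (0 < a)%N -> (N <= k)%N -> (N <= l)%N ->
  eqm N (pr a a * qbin (q ^+ a) (k + l) k) 1.
Proof.
move=> a0 Nk Nl; apply: (@eqm_cancel _ (pr a a)); first exact: pr0.
have /eqm_sym := @eqm_qfac a N (k + l) a0 (leq_trans Nk (leq_addr _ _)).
rewrite mulr1 -qbin_qfac; move/eqm_sym => E; apply: eqm_trans E.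
rewrite mulrA mulrC; apply: eqmM => //.
by apply: eqmM; apply/eqm_sym/eqm_qfac.
Qed.

(** In the finite identity the k-th term is negligible for k large because of
    u k, and for the other k its Gaussian binomial has reached its limit. *)
Lemma triple_product a (c : fps) (u : nat -> fps) :
    (0 < a)%N -> eqm 1 c 0 -> (forall k, eqm k (u k) 0) ->
    u 0%N = 1 -> u 1%N = c + q ^+ a ->
    (forall k, u k.+2 = c * q ^+ (a * k.+1) * u k.+1 - q ^+ (a * (2 * k + 3)) * u k) ->
  pr a a * pinf (fun k => 1 - c * q ^+ (a * k) + q ^+ (a * (2 * k + 2))) =
  fsum (fun k => (-1) ^+ k * u k).
Proof.
move=> a0 c0 uk u0 u1 uS; apply: eqmP => N.
have uni : unital (fun k => 1 - c * q ^+ (a * k) + q ^+ (a * (2 * k + 2))).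
  move=> k; rewrite -[X in eqm _ _ X]addr0; apply: eqmD; last first.
    by apply: eqm_q0; have := leq_pmull (2 * k + 2) a0; lia.
  rewrite -[X in eqm _ _ X]subr0; apply: eqmD => //; apply: eqmN.
  rewrite -add1n; apply: eqm0MM => //; apply: eqm_q0.
  by have := leq_pmull k a0; lia.
(* The finite identity is taken at n = 2 N: then either k >= N, or both n - k and
   n + k + 1 are at least N. *)
have leN : (N <= N + N)%N by rewrite leq_addr.
apply: eqm_trans (eqmM (@eqm_refl N (pr a a)) (eqm_pinf uni leN)) _.
have -> : \prod_(k < N + N) (1 - c * q ^+ (a * k) + q ^+ (a * (2 * k + 2))) =
          \prod_(k < N + N) (1 - c * (q ^+ a) ^+ k + (q ^+ a) ^+ (2 * k + 2)).
  by apply: eq_bigr => k _; rewrite !exprM.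
rewrite (@finite_triple_product _ _ _ u) //; last by move=> k; rewrite -!exprM uS.
rewrite mulr_sumr.
apply: (@eqm_trans _ (\sum_(k < (N + N).+1) (-1) ^+ k * u k)).
  apply: eqm_sum => k _; rewrite mulrA mulrCA -mulrA.
  have [ltkN | leNk] := ltnP k N; last first.
    have uk0 : eqm N (u k) 0 by apply: eqm_le (uk k).
    apply: (@eqm_trans _ 0); first by do 2!apply: eqm0Ml.
    by apply/eqm_sym/eqm0Ml.
  apply: eqmM => //; rewrite -[X in eqm _ _ X]mul1r; apply: eqmM => //.
  have -> : ((N + N).*2.+1 = (N + N - k) + (N + N + k.+1))%N by lia.
  by apply: eqm_qbin => //; lia.
move=> m ltm; rewrite (@fsum_box _ _ _ (N + N)); last first.
  move=> k; rewrite mem_box_nat => lek; apply: (@eqm0Ml N) => //.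
  by apply: eqm_le (uk k); lia.
by rewrite fps_sum /= -/(iota 0 (N + N).+1) -[iota _ _]/(index_iota 0 (N + N).+1) big_mkord.
Qed.

(** * The theta series of the proof as products *)

(** The Jacobi theta series in base q ^ (2 a) at the point q ^ b.  The cases used
    are theta 2 2 = phi(- q ^ 2) and theta 6 2. *)
Definition theta (a b : nat) : fps :=
  fsum (fun c : int => mon (eps c) (a%:Z * c ^+ 2 + (a%:Z - b%:Z) * c)).

Lemma summable_theta a b : (0 < b)%N -> (b < 2 * a)%N ->
  summable (fun c : int => mon (eps c) (a%:Z * c ^+ 2 + (a%:Z - b%:Z) * c)).
Proof.
move=> b0 ba; apply: summable_mon => N; exists N => c _.
rewrite mem_box_int => ltN; nia.
Qed.

(** The triple product at z = q ^ b.  The geometric sum u k is the sequence of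
    [finite_triple_product]; its closed form needs a division by 1 - q ^ b, which
    supplies the factor missing from the product. *)
Lemma theta_product a b : (0 < b)%N -> (b < 2 * a)%N ->
  theta a b = pr (2 * a) b * pr (2 * a) (2 * a - b) * pr (2 * a) (2 * a).
Proof.
move=> b0 ba; have a0 : (0 < 2 * a)%N by lia.
pose e k := (a * k * k.+1 - b * k)%N.
pose u k : fps := q ^+ e k * \sum_(i < (2 * k).+1) (q ^+ b) ^+ i.
have le_e k : (b * k <= a * k * k.+1)%N by rewrite mulnAC leq_mul2r; nia.
have eE k : (e k + b * k = a * k * k.+1)%N by rewrite subnK.
have eS k : (e k.+1 + b = e k + 2 * a * k.+1)%N by have := eE k; have := eE k.+1; nia.
have uE k : (1 - q ^+ b) * u k = q ^+ e k * (1 - q ^+ (b * (2 * k).+1)).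
  rewrite mulrCA [q ^+ (b * _)]exprM; congr (_ * _).
  rewrite -[in RHS](opprB (_ ^+ _)) subrX1; ring.
have qb0 : (1 - q ^+ b) 0%N = 1 by rewrite fpsD fpsN coef_qn fps1; case: (b) b0.
pose c : fps := q ^+ (2 * a + b) + q ^+ (2 * a - b).
have -> : pr (2 * a) b * pr (2 * a) (2 * a - b) * pr (2 * a) (2 * a) =
    (1 - q ^+ b) * (pr (2 * a) (2 * a) *
      pinf (fun k => 1 - c * q ^+ (2 * a * k) + q ^+ (2 * a * (2 * k + 2)))).
  have pM : pinf (fun k => 1 - c * q ^+ (2 * a * k) + q ^+ (2 * a * (2 * k + 2))) =
            pr (2 * a) (2 * a + b) * pr (2 * a) (2 * a - b).
    rewrite -pinfM; try by apply: unital_pr; lia.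
    apply: eq_pinf => k; rewrite /c.
    have -> : (2 * a * (2 * k + 2) = (2 * a * k + (2 * a + b)) + (2 * a * k + (2 * a - b)))%N.
      by lia.
    by rewrite !exprD; ring.
  by rewrite (@pr_recl (2 * a) b) // pM; ring.
rewrite (@triple_product _ c u) //.
- have sN : summable (fun k : nat => (-1) ^+ k * u k).
    apply: summable_nat => n m ltmn; rewrite (@eqm0Ml n) //; apply: eqm0M.
    by apply: eqm_q0; have := eE n; nia.
  rewrite -fsumMl // /theta fsum_int; last exact: summable_theta.
  rewrite -fsumD; last first.
  + exact: (@summable_inj _ _ _ _ Negz (fun n => `|n|%N.-1)) (summable_theta b0 ba).
  + exact: (@summable_inj _ _ _ _ Posz absz) (summable_theta b0 ba).
  apply: eq_fsum => k; rewrite [RHS]mulrCA uE mulrBr mulr1 -exprD mulrBr !qE !signM !mulr1 monN.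
  have := eE k => Ek; rewrite eps_Posz eps_Negz [(-1) ^+ k.+1]exprS mulN1r; congr (mon _ _ + mon _ _); nia.
- by move=> [|[]] //; rewrite /c fpsD !coef_qn fps0; move=> _; lia.
- move=> k; apply: eqm0M; apply: eqm_q0; have := eE k; nia.
- by rewrite /u big_ord1 /e !muln0 !expr0 mulr1.
- have E1 : (e 1%N + b = 2 * a)%N by have := eE 1%N; lia.
  rewrite /u !big_ord_recr big_ord0 /= /c add0r expr0 expr1 mulrDr mulrDr mulr1 -exprM -!exprD.
  rewrite E1; have -> : (e 1%N + b * 2 = 2 * a + b)%N by lia.
  have -> : (e 1%N = 2 * a - b)%N by lia.
  ring.
- move=> k; apply: (fps_cancel qb0); rewrite uE.
  have -> : (1 - q ^+ b) * (c * q ^+ (2 * a * k.+1) * u k.+1 - q ^+ (2 * a * (2 * k + 3)) * u k)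
    = c * q ^+ (2 * a * k.+1) * ((1 - q ^+ b) * u k.+1)
      - q ^+ (2 * a * (2 * k + 3)) * ((1 - q ^+ b) * u k) by ring.
  rewrite !uE /c.
  have -> : (q ^+ (2 * a + b) + q ^+ (2 * a - b)) * q ^+ (2 * a * k.+1) * (q ^+ e k.+1 * (1 - q ^+ (b * (2 * k.+1).+1))) = (q ^+ (2 * a + b + 2 * a * k.+1 + e k.+1) + q ^+ (2 * a - b + 2 * a * k.+1 + e k.+1)) * (1 - q ^+ (b * (2 * k.+1).+1)).
    by rewrite !exprD; ring.
  have := eS k; have := eS k.+1 => E1 E2.
  have -> : (2 * a + b + 2 * a * k.+1 + e k.+1 = e k.+2 + b * 2)%N by lia.
  have -> : (2 * a - b + 2 * a * k.+1 + e k.+1 = e k.+2)%N by lia.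
  have -> : q ^+ (2 * a * (2 * k + 3)) * (q ^+ e k * (1 - q ^+ (b * (2 * k).+1)))
     = q ^+ (e k.+2 + b * 2) * (1 - q ^+ (b * (2 * k).+1)).
    by rewrite mulrA -exprD; congr (q ^+ _ * _); lia.
  have -> : (b * (2 * k.+1).+1 = b * 2 + b * (2 * k).+1)%N by lia.
  have -> : (b * (2 * k.+2).+1 = b * 2 + b * 2 + b * (2 * k).+1)%N by lia.
  rewrite !exprD; ring.
Qed.

(** The series of Jacobi's identity: the terms of n and - 1 - n add up to
    (-1) ^ n (2 n + 1) q ^ (n (n + 1)). *)
Definition cube_series : fps := fsum (fun n : int => mon (eps n * n) (n ^+ 2 + n)).

Lemma summable_cube_series : summable (fun n : int => mon (eps n * n) (n ^+ 2 + n)).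
Proof.
apply: summable_mon => N; exists N.+1 => n _; rewrite mem_box_int => ltN; nia.
Qed.

(** The triple product at z = 1, in base q ^ 2. *)
Lemma jacobi_cube : cube_series = pr 2 2 ^+ 3.
Proof.
pose u k : fps := (2 * k + 1)%:R * q ^+ (k * k.+1).
have u0 k : eqm k (u k) 0 by apply: eqm0Ml; apply: eqm_q0; nia.
have -> : pr 2 2 ^+ 3 =
    pr 2 2 * pinf (fun k => 1 - 2%:R * q ^+ 2 * q ^+ (2 * k) + q ^+ (2 * (2 * k + 2))).
  rewrite exprS; congr (_ * _); rewrite expr2 /pr -pinfM; try exact: unital_pr.
  apply: eq_pinf => k; have -> : (2 * (2 * k + 2) = (2 * k + 2) + (2 * k + 2))%N by lia.
  by rewrite !exprD; ring.
rewrite (@triple_product _ _ u) //.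
- rewrite /cube_series fsum_int; last exact: summable_cube_series.
  rewrite -fsumD; last first.
  + exact: (@summable_inj _ _ _ _ Negz (fun n => `|n|%N.-1)) summable_cube_series.
  + exact: (@summable_inj _ _ _ _ Posz absz) summable_cube_series.
  apply: eq_fsum => k; rewrite eps_Posz eps_Negz [(-1) ^+ k.+1]exprS /u qE natM_mon signM.
  have -> : Negz k ^+ 2 + Negz k = (k * k.+1)%N%:Z by nia.
  have -> : Posz k ^+ 2 + k = (k * k.+1)%N%:Z by nia.
  rewrite monD natz; congr mon; nia.
- by apply: eqm0Ml; apply: eqm_q0.
- by rewrite /u !expr0 mulr1.
- by rewrite /u -[(1 * 2)%N]/2%N; ring.
move=> k; rewrite /u.
have -> : (k.+2 * k.+3 = k * k.+1 + 4 * k + 6)%N by lia.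
have -> : (k.+1 * k.+2 = k * k.+1 + 2 * k + 2)%N by lia.
have -> : (2 * k.+1 = 2 * k + 2)%N by lia.
have -> : (2 * (2 * k + 3) = 2 * k + 2 * k + 6)%N by lia.
have -> : (4 * k = 2 * k + 2 * k)%N by lia.
rewrite !exprD !natrD; ring.
Qed.

(** The products (- q ^ b; q ^ a)_oo. *)
Definition prN a b : fps := pinf (fun k => 1 + q ^+ (a * k + b)).

Lemma prN_pr a : (0 < a)%N -> prN a a * pr a a = pr (2 * a) (2 * a).
Proof.
move=> a0; rewrite -pinfM; [|exact: unital_prN|exact: unital_pr].
apply: eq_pinf => k; have -> : (2 * a * k + 2 * a = (a * k + a) * 2)%N by lia.
by rewrite exprM; ring.
Qed.

Definition psi3 : fps := fsum (fun k : nat => q ^+ (3 * k * k.+1)).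

(** The triple product at z = - 1, in base q ^ 6. *)
Lemma psi3_product : psi3 = pr 6 6 * prN 6 6 ^+ 2.
Proof.
pose u k : fps := (-1) ^+ k * q ^+ (3 * k * k.+1).
have -> : pr 6 6 * prN 6 6 ^+ 2 =
    pr 6 6 * pinf (fun k => 1 - - 2%:R * q ^+ 6 * q ^+ (6 * k) + q ^+ (6 * (2 * k + 2))).
  congr (_ * _); rewrite expr2 -pinfM; try exact: unital_prN.
  apply: eq_pinf => k; have -> : (6 * (2 * k + 2) = (6 * k + 6) + (6 * k + 6))%N by lia.
  by rewrite !exprD; ring.
rewrite (@triple_product _ _ u) //.
- apply: eq_fsum => k; by rewrite /u mulrA -expr2 sqrr_sign mul1r.
- by apply: eqm0Ml; apply: eqm_q0.
- by move=> k; apply: eqm0Ml; apply: eqm_q0; nia.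
- by rewrite /u !expr0 mulr1.
- by rewrite /u -[(3 * 1 * 2)%N]/6%N; ring.
move=> k; rewrite /u.
have -> : (3 * k.+2 * k.+3 = 3 * k * k.+1 + 6 * k + 6 * k + 18)%N by lia.
have -> : (3 * k.+1 * k.+2 = 3 * k * k.+1 + 6 * k + 6)%N by lia.
have -> : (6 * k.+1 = 6 * k + 6)%N by lia.
have -> : (6 * (2 * k + 3) = 6 * k + 6 * k + 18)%N by lia.
rewrite !exprD !exprS; ring.
Qed.

(** With the product formulas inserted, everything reduces to Euler's identity
    (-x; x)_oo (x; x^2)_oo = 1 for x = q ^ 2 and x = q ^ 6 (I2 and I6) and to the
    decomposition of q ^ 2, q ^ 6, q ^ 10, ... into residue classes modulo 12
    (S4). *)
Lemma product_identity :
  theta 2 2 ^+ 3 * (prN 2 2 ^+ 2 * psi3) = cube_series * theta 6 2.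
Proof.
rewrite jacobi_cube psi3_product !theta_product //=.
rewrite -![(2 * 2)%N]/4%N -![(2 * 6)%N]/12%N -[(4 - 2)%N]/2%N -[(12 - 2)%N]/10%N.
have E1 : prN 2 2 * pr 2 2 = pr 4 4 := @prN_pr 2 isT.
have E2 : prN 6 6 * pr 6 6 = pr 12 12 := @prN_pr 6 isT.
have S2 : pr 2 2 = pr 4 2 * pr 4 4.
  by rewrite (@pr_residues 2 2 2) // !big_ord_recr big_ord0 /= mul1r.
have S6 : pr 6 6 = pr 12 6 * pr 12 12.
  by rewrite (@pr_residues 2 6 6) // !big_ord_recr big_ord0 /= mul1r.
have S4 : pr 4 2 = pr 12 2 * pr 12 6 * pr 12 10.
  by rewrite (@pr_residues 3 4 2) // !big_ord_recr big_ord0 /= mul1r.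
have I2 : prN 2 2 * pr 4 2 = 1.
  by apply: (@fps_cancel (pr 4 4)); rewrite ?pr0 // mulr1 -[in RHS]E1 S2; ring.
have I6 : prN 6 6 * pr 12 6 = 1.
  by apply: (@fps_cancel (pr 12 12)); rewrite ?pr0 // mulr1 -[in RHS]E2 S6; ring.
apply: (@fps_cancel (pr 12 6)); first by rewrite pr0.
transitivity ((prN 2 2 * pr 4 2) ^+ 2 * (prN 6 6 * pr 12 6) * (prN 6 6 * pr 6 6) * pr 4 2 ^+ 4 * pr 4 4 ^+ 3).
  ring.
rewrite I2 I6 E2 S2.
transitivity (pr 4 2 ^+ 3 * pr 4 4 ^+ 3 * (pr 12 2 * pr 12 6 * pr 12 10) * pr 12 12).
  by rewrite -S4; ring.
ring.
Qed.

(** * The mock theta function as an indefinite theta series *)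

Lemma bin2S n : 'C(n.+1, 2) = ('C(n, 2) + n)%N.
Proof. by rewrite binS bin1 addnC. Qed.

Lemma double_bin2 n : (2 * 'C(n.+1, 2) = n * n.+1)%N.
Proof. by elim: n => // n IHn; rewrite bin2S mulnDr IHn; lia. Qed.

Section InnerSum.
Variables (R : comNzRingType) (x : R).

(** The exponent is n (n + 1) - j (j + 1) / 2 for j = n - 2 s.  As j and - 1 - j
    give the same value, j may also be taken to run over 0, ..., n; the form in s
    is the one that leads to a sum over a quadrant. *)
Definition inner_sum n : R :=
  \sum_(s < n.+1) x ^+ ('C((n - s).+1, 2) + 'C(s.+1, 2) + s + 3 * (n - s) * s).

(** At level n + 1 the values j = n - 1, n - 3, ..., - n - 1 are those of level n
    under j -> - 1 - j; the new one is j = n + 1. *)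
Lemma inner_sumS n :
  inner_sum n.+1 = x ^+ (2 * n.+1) * inner_sum n + x ^+ 'C(n.+2, 2).
Proof.
rewrite /inner_sum big_ord_recl /= subn0 muln0 (@bin_small 1) // !addn0 addrC.
congr (_ + _); rewrite mulr_sumr (reindex_inj rev_ord_inj) /=.
apply: eq_bigr => s _; have lts := ltn_ord s; rewrite -exprD; congr (_ ^+ _).
rewrite /bump /= add1n subSS; move: (nat_of_ord s) lts => {}s lts.
have [t nE] : exists t, n = (s + t)%N by exists (n - s)%N; lia.
have -> : (n.+1 - s.+1 = t)%N by lia.
have -> : (n - t = s)%N by lia.
have -> : (n - s = t)%N by lia.
by rewrite (bin2S t.+1) nE; lia.
Qed.

Definition even_fac n : R := \prod_(k < n) (1 - x ^+ (2 * k + 2)).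

(** The right-hand side satisfies the recurrence of [inner_sumS]: its terms do so
    up to a difference g (j + 1) - g j, and the sum of these differences is the
    inhomogeneous term of the recurrence. *)
Lemma inner_sum_qbin n :
  inner_sum n = \sum_(j < n.+1)
    (-1) ^+ j * x ^+ 'C(n - j, 2) * qbin x (n + j).+1 (2 * j).+1 * even_fac j.
Proof.
elim: n => [|n IHn].
  rewrite /inner_sum !big_ord1 /even_fac big_ord0 /= !bin_small //.
  by rewrite -[qbin _ _ _]/(qbin x 1 1) qbinn; ring.
pose g j := - ((-1) ^+ j * x ^+ 'C(n.+2 - j, 2) * qbin x (n.+1 + j) (2 * j) * even_fac j).
rewrite inner_sumS IHn mulr_sumr.
have fE j : (j < n.+1)%N ->
    (-1) ^+ j * x ^+ 'C(n.+1 - j, 2) * qbin x (n.+1 + j).+1 (2 * j).+1 * even_fac j =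
    x ^+ (2 * n.+1) *
      ((-1) ^+ j * x ^+ 'C(n - j, 2) * qbin x (n + j).+1 (2 * j).+1 * even_fac j)
    + (g j.+1 - g j).
  move=> ltj; rewrite /g.
  have [k nE] : exists k, n = (j + k)%N by exists (n - j)%N; lia.
  have -> : (n.+1 - j = k.+1)%N by lia.
  have -> : (n.+2 - j.+1 = k.+1)%N by lia.
  have -> : (n.+2 - j = k.+2)%N by lia.
  have -> : (n - j = k)%N by lia.
  have -> : (2 * j.+1 = (2 * j).+2)%N by lia.
  have -> : (n.+1 + j.+1 = (n + j).+2)%N by lia.
  rewrite addSn !bin2S !exprD exprS {3}/even_fac big_ord_recr /= -/(even_fac j).
  have -> : x ^+ (2 * n.+1) = x ^+ k * x ^+ k.+1 * x ^+ (2 * j).+1.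
    by rewrite -!exprD; congr (_ ^+ _); lia.
  have -> : x ^+ (2 * j + 2) = x ^+ (2 * j).+2 by congr (_ ^+ _); lia.
  have := @qbin_step _ x (n + j).+2 (2 * j).+1 ltac:(lia).
  have -> : ((n + j).+2 - (2 * j).+1 = k.+1)%N by lia.
  set Q3 := qbin x _ (2 * j).+2 => E.
  transitivity (x ^+ k * x ^+ k.+1 * x ^+ (2 * j).+1 *
      ((-1) ^+ j * x ^+ 'C(k, 2) * qbin x (n + j).+1 (2 * j).+1 * even_fac j)
    + (-1) ^+ j * x ^+ 'C(k, 2) * x ^+ k * even_fac j * ((1 - x ^+ (2 * j).+2) * Q3)
    + (-1) ^+ j * x ^+ 'C(k, 2) * x ^+ k * x ^+ k.+1 * even_fac j * qbin x (n + j).+1 (2 * j)).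
    by rewrite E [qbin x (n + j).+2 _]qbinS; ring.
  ring.
rewrite [RHS]big_ord_recr /=.
under [in RHS]eq_bigr => j _ do rewrite (fE _ (ltn_ord j)).
rewrite big_split /= -addrA; congr (_ + _).
rewrite -(big_mkord xpredT (fun j => g j.+1 - g j)) telescope_sumr //.
have -> : g n.+1 = - ((-1) ^+ n.+1 * x ^+ 'C(n.+1 - n.+1, 2) *
    qbin x (n.+1 + n.+1).+1 (2 * n.+1).+1 * even_fac n.+1).
  rewrite /g; have -> : (n.+1 + n.+1 = 2 * n.+1)%N by lia.
  by rewrite !qbinn subSn // subnn !bin_small.
rewrite /g subn0 muln0 qbin0 /even_fac big_ord0 expr0; ring.
Qed.

End InnerSum.

Definition phi_neg : fps := fsum (fun t : int => mon (eps t) (t ^+ 2)).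

Lemma summable_phi_neg : summable (fun t : int => mon (eps t) (t ^+ 2)).
Proof.
apply: summable_mon => N; exists N => t _; rewrite mem_box_int => ltN; nia.
Qed.

Definition neg_fac n : fps := \prod_(k < n) (1 + q ^+ k.+1).
Definition odd_fac n : fps := \prod_(k < n) (1 - q ^+ (2 * k).+1).

Lemma qfac_odd_even j : qfac q (2 * j).+1 = odd_fac j.+1 * even_fac q j.
Proof.
elim: j => [|j IHj].
  by rewrite /qfac /odd_fac /even_fac !big_ord1 big_ord0 mulr1.
have -> : (2 * j.+1).+1 = (2 * j).+3 by lia.
rewrite 2!qfacS IHj /odd_fac /even_fac [X in _ = X * _]big_ord_recr [X in _ = _ * X]big_ord_recr /=.
have -> : (2 * j.+1).+1 = (2 * j).+3 by lia.
have -> : (2 * j + 2 = (2 * j).+2)%N by lia.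
ring.
Qed.

(** The coefficient of the expansion of phi(- q) times the j-th term of sigma,
    up to factors that depend on j only. *)
Definition phi_term j m : fps :=
  (-1) ^+ m * q ^+ (m ^ 2 + m + m * j) * (1 - q ^+ (m + j).+1) * qbin q (2 * j + m).+1 m.

Lemma eqm_phi_term j m : eqm m (phi_term j m) 0.
Proof. by rewrite /phi_term -!mulrA; apply/eqm0Ml/eqm0M/eqm_q0; nia. Qed.

(** The terms at j + 1 and at j are proportional up to a difference
    g (m + 1) - g m. *)
Lemma phi_term_step j m :
  let g m := (-1) ^+ m * q ^+ (m ^ 2 + m + m * j) * qbin q (2 * j + m).+1 m *
             (1 - q ^+ m) * (1 + q ^+ j.+1 - q ^+ ((2 * j).+2 + m)) in
  (1 - q ^+ (2 * j).+2) * (1 - q ^+ (2 * j).+3) * phi_term j.+1 m =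
  (1 + q ^+ j.+1) * phi_term j m + (g m.+1 - g m).
Proof.
rewrite /= /phi_term; have [e eE] : exists e, e = (m ^ 2 + m + m * j)%N by eexists.
have -> : (2 * j.+1 + m).+1 = (2 * j + m).+3 by lia.
have -> : (2 * j + m.+1).+1 = (2 * j + m).+2 by lia.
have -> : (m.+1 ^ 2 + m.+1 + m.+1 * j = e + (m + m + 2 + j))%N by nia.
have -> : (m ^ 2 + m + m * j.+1 = e + m)%N by nia.
rewrite -eE {eE}.
have U1 := @qbin_up _ q (2 * j + m).+2 m ltac:(lia).
have U2 := @qbin_up _ q (2 * j + m).+1 m ltac:(lia).
have U3 := @qbin_absorb _ q (2 * j + m).+1 m.
have e1 : ((2 * j + m).+3 - m = (2 * j).+3)%N by lia.
have e2 : ((2 * j + m).+2 - m = (2 * j).+2)%N by lia.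
rewrite {}e1 in U1; rewrite {}e2 in U2.
move: U1 U2 U3; set B3 := qbin q (2 * j + m).+3 m; set B2 := qbin q (2 * j + m).+2 m.
set B2' := qbin q (2 * j + m).+2 m.+1; set B := qbin q (2 * j + m).+1 m => U1 U2 U3.
set s : fps := (-1) ^+ m; set p := q ^+ e.
rewrite !exprD [(-1) ^+ m.+1]exprS -/s -/p.
transitivity (s * p * q ^+ m * (1 - q ^+ (m + j.+1).+1) *
   ((1 - q ^+ (2 * j).+2) * ((1 - q ^+ (2 * j).+3) * B3))); first by ring.
rewrite U1 [(1 - q ^+ (2 * j).+2) * (_ * B2)]mulrCA U2.
transitivity ((1 + q ^+ j.+1) * (s * p * (1 - q ^+ (m + j).+1) * B) +
 (- (s * p * q ^+ m * q ^+ m * q ^+ 2 * q ^+ j * (1 + q ^+ j.+1 - q ^+ (2 * j).+2 * q ^+ m.+1) *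
    ((1 - q ^+ m.+1) * B2')) - s * p * B * (1 - q ^+ m) * (1 + q ^+ j.+1 - q ^+ (2 * j).+2 * q ^+ m))).
  rewrite U3.
  have -> : (m + j.+1).+1 = (m + j + 2)%N by lia.
  have -> : (m + j).+1 = (m + j + 1)%N by lia.
  have -> : (2 * j + m).+3 = (j + j + m + 3)%N by lia.
  have -> : (2 * j + m).+2 = (j + j + m + 2)%N by lia.
  have -> : (2 * j).+2 = (j + j + 2)%N by lia.
  rewrite !exprS !exprD; ring.
ring.
Qed.

(** By [phi_term_step] the quotient of the two sides does not depend on j; for
    j = 0 the series on the left telescopes to phi(- q). *)
Lemma phi_term_sum j :
  qfac q (2 * j).+1 * fsum (phi_term j) = neg_fac j * phi_neg.
Proof.
have sV i := summable_eqm (eqm_phi_term i).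
elim: j => [|j IHj].
  rewrite /neg_fac big_ord0 mul1r /qfac big_ord1 expr1 -fsumMl //.
  (* (1 - q^(m+1))^2 is expanded; the outer terms telescope and the middle one
     gives the two halves of phi(- q). *)
  pose A m : fps := (-1) ^+ m * q ^+ (m ^ 2 + m).
  pose S m : fps := (-1) ^+ m * q ^+ (m ^ 2).
  have sA : summable A by apply: summable_eqm => n; apply/eqm0Ml/eqm_q0; nia.
  have sS : summable S by apply: summable_eqm => n; apply/eqm0Ml/eqm_q0; nia.
  have sS1 : summable (fun n => S n.+1) by exact: (@summable_inj _ _ _ _ succn predn).
  have sA1 : summable (fun n => A n.+1) by exact: (@summable_inj _ _ _ _ succn predn).
  have VE m : (1 - q) * phi_term 0 m = - (A m.+1 - A m) + (S m.+1 + S m.+1).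
    have := @qbin_up _ q m m ltac:(lia).
    rewrite subSn // subnn qbinn expr1 mulr1 => U.
    rewrite /phi_term !muln0 add0n addn0 mulrCA U.
    rewrite /A /S !addn0.
    have -> : (m.+1 ^ 2 + m.+1 = m ^ 2 + m + m.+1 + m.+1)%N by nia.
    have -> : (m.+1 ^ 2 = m ^ 2 + m + m.+1)%N by nia.
    rewrite !exprD [(-1) ^+ m.+1]exprS; ring.
  rewrite (eq_fsum VE) fsumD; last first.
  - exact: summableD.
  - by apply: summableN; apply: summableD => //; apply: summableN.
  rewrite fsumN fsum_telescope // fsumD // opprK.
  rewrite /phi_neg fsum_int; last exact: summable_phi_neg.
  have -> : fsum (fun n => mon (eps (Posz n)) (Posz n ^+ 2)) = fsum S.
    by apply: eq_fsum => n; rewrite /S qE signM mulr1 eps_Posz; congr mon; nia.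
  have -> : fsum (fun n => mon (eps (Negz n)) (Negz n ^+ 2)) = fsum (fun n => S n.+1).
    by apply: eq_fsum => n; rewrite /S qE signM mulr1 eps_Negz; congr mon; nia.
  by rewrite (fsum_recl sS) /A /S; ring.
pose g m : fps := (-1) ^+ m * q ^+ (m ^ 2 + m + m * j) * qbin q (2 * j + m).+1 m *
             (1 - q ^+ m) * (1 + q ^+ j.+1 - q ^+ ((2 * j).+2 + m)).
have sg : summable g.
  by apply: summable_eqm => n; rewrite /g -!mulrA; apply/eqm0Ml/eqm0M/eqm_q0; nia.
have -> : (2 * j.+1).+1 = (2 * j).+3 by lia.
rewrite 2!qfacS /neg_fac big_ord_recr /= -/(neg_fac j) [RHS]mulrAC -IHj.
transitivity (qfac q (2 * j).+1 *
   ((1 - q ^+ (2 * j).+2) * (1 - q ^+ (2 * j).+3) * fsum (phi_term j.+1))); first by ring.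
have step m : (1 - q ^+ (2 * j).+2) * (1 - q ^+ (2 * j).+3) * phi_term j.+1 m =
    (1 + q ^+ j.+1) * phi_term j m + (g m.+1 - g m) := phi_term_step j m.
have sg1 : summable (fun m => g m.+1) by exact: (@summable_inj _ _ _ _ succn predn).
rewrite -fsumMl // (eq_fsum step) fsumD; last first.
- exact: summableD sg1 (summableN sg).
- exact: summableMl.
rewrite fsumMl // (fsum_telescope sg) /g expr0; ring.
Qed.

Definition of_poly (p : {poly int}) : fps := fun n => p`_n.

Lemma of_polyM p r : of_poly (p * r) = of_poly p * of_poly r.
Proof. by apply: fpsP => n; rewrite fpsM /of_poly coefM. Qed.
Lemma of_polyD p r : of_poly (p + r) = of_poly p + of_poly r.
Proof. by apply: fpsP => n; rewrite fpsD /of_poly coefD. Qed.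
Lemma of_polyN p : of_poly (- p) = - of_poly p.
Proof. by apply: fpsP => n; rewrite fpsN /of_poly coefN. Qed.
Lemma of_polyXn k : of_poly 'X^k = q ^+ k.
Proof. by apply: fpsP => n; rewrite coef_qn /of_poly coefXn. Qed.
Lemma of_poly1 : of_poly 1 = 1.
Proof. by rewrite -(expr0 'X) of_polyXn expr0. Qed.
Lemma of_poly_prod (I : Type) (r : seq I) (P : pred I) (F : I -> {poly int}) :
  of_poly (\prod_(i <- r | P i) F i) = \prod_(i <- r | P i) of_poly (F i).
Proof. exact: (big_morph _ of_polyM of_poly1). Qed.

(** The quotient series is characterized by multiplication; this gives access to
    sigma without its geometric sums. *)
Lemma fps_div_of_poly (f g : {poly int}) : g`_0 = 1 ->
  of_poly g * (fps_div f g : fps) = of_poly f.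
Proof. move=> g0; apply: fpsP => m; rewrite fpsM; exact: fps_divP. Qed.

Lemma sigma_termE j :
  odd_fac j.+1 * (sigma_term j : fps) = q ^+ 'C(j.+2, 2) * neg_fac j.
Proof.
have <- : of_poly (qpoch 'X 'X^2 j.+1) = odd_fac j.+1.
  rewrite of_poly_prod; apply: eq_bigr => k _.
  by rewrite of_polyD of_polyN of_poly1 -exprM -exprS of_polyXn.
rewrite fps_div_of_poly; last by rewrite qpoch_coef0 // coefX.
rewrite of_polyM of_polyXn of_poly_prod; congr (q ^+ _ * _).
  by have := double_bin2 j.+1; rewrite addn1 addn2; lia.
apply: eq_bigr => k _.
by rewrite mulNr opprK of_polyD of_poly1 -exprS of_polyXn.
Qed.

Lemma sigma_term_summable : summable (fun j => sigma_term j : fps).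
Proof. by apply: summable_nat => j m ltm; apply: sigma_term_eq0; apply: ltnW. Qed.

Lemma odd_fac0 j : odd_fac j 0%N = 1.
Proof. by apply: fps_prod0 => k _; rewrite fpsD fpsN coef_qn. Qed.

Definition nonneg (n : int) : int := (0 <= n)%R%:R.
(** The value is 1 on the quadrant r, s >= 0, - 1 on the quadrant r, s < 0, and 0
    elsewhere ([quadrantP]).  As a function of r plus a function of s it changes
    in a simple way under translations of r and of s. *)
Definition quadrant (r s : int) : int := nonneg r + nonneg s - 1.

Lemma quadrantP r s : quadrant r s =
  if (0 <= r) && (0 <= s) then 1 else if (r < 0) && (s < 0) then -1 else 0.
Proof. by rewrite /quadrant /nonneg; case: (leP 0 r); case: (leP 0 s). Qed.

Definition hecke_term (p : int * int) : fps :=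
  mon (quadrant p.1 p.2 * eps (p.1 + p.2))
      (p.1 ^+ 2 + p.2 ^+ 2 + 4 * p.1 * p.2 + 2 * p.1 + 3 * p.2 + 1).

Lemma summable_hecke_term : summable hecke_term.
Proof.
apply: summable_mon => N; exists N => -[r s].
rewrite mem_box_prod !mem_box_int /= quadrantP.
case: ifP => [/andP[r0 s0] _ ltN | _]; first by apply/andP; split; nia.
by case: ifP => [/andP[r0 s0] _ ltN | _]; [apply/andP; split; nia | rewrite mul0r].
Qed.

(** The contribution of inner_sum (r + s) at s; the two terms of the factor
    1 - q ^ (r + s + 1) correspond to the two quadrants. *)
Definition hecke_nat r s : fps :=
  (-1) ^+ (r + s) * q ^+ 'C((r + s).+2, 2) * (1 - q ^+ (r + s).+1) *
  q ^+ ('C(r.+1, 2) + 'C(s.+1, 2) + s + 3 * r * s).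

(** The second quadrant is parametrized by (- 1 - s, - 1 - r), in this order. *)
Lemma hecke_natE r s : hecke_nat r s = hecke_term (Posz r, Posz s) +
  hecke_term (Negz s, Negz r).
Proof.
rewrite /hecke_nat /hecke_term /=.
have E : (2 * ('C((r + s).+2, 2) + ('C(r.+1, 2) + 'C(s.+1, 2) + s + 3 * r * s)) =
          2 * (r ^ 2 + s ^ 2 + 4 * r * s + 2 * r + 3 * s + 1))%N.
  have := double_bin2 (r + s).+1; have := double_bin2 r; have := double_bin2 s; nia.
transitivity ((-1) ^+ (r + s) * q ^+ (r ^ 2 + s ^ 2 + 4 * r * s + 2 * r + 3 * s + 1) -
  (-1) ^+ (r + s) * q ^+ (r ^ 2 + s ^ 2 + 4 * r * s + 3 * r + 4 * s + 2)).
  have -> : (r ^ 2 + s ^ 2 + 4 * r * s + 3 * r + 4 * s + 2 =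
     ('C((r + s).+2, 2) + ('C(r.+1, 2) + 'C(s.+1, 2) + s + 3 * r * s)) + (r + s).+1)%N by nia.
  have -> : (r ^ 2 + s ^ 2 + 4 * r * s + 2 * r + 3 * s + 1 =
     'C((r + s).+2, 2) + ('C(r.+1, 2) + 'C(s.+1, 2) + s + 3 * r * s))%N by nia.
  rewrite !exprD; ring.
rewrite !qE !signM !mulr1 monN !quadrantP /=.
have -> : eps (Negz s + Negz r) = eps (Posz (r + s)).
  by rewrite -epsN -[RHS]mul1r -(eps_even 1) -epsD; congr eps; lia.
rewrite -PoszD eps_Posz; congr (mon _ _ + mon _ _); nia.
Qed.

Definition hecke_series : fps := fsum hecke_term.

Lemma summable_hecke_nat : summable (fun p : nat * nat => hecke_nat p.1 p.2).
Proof.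
move=> N; exists N => -[r s] m ltm; rewrite mem_box_prod !mem_box_nat /= => rs.
apply: (@eqm0M N) => //; apply: eqm0M; apply: eqm0Ml; apply: eqm_q0.
by have := double_bin2 (r + s).+1; nia.
Qed.

Lemma hecke_series_nat :
  hecke_series = fsum (fun p : nat * nat => hecke_nat p.1 p.2).
Proof.
pose P0 (p : int * int) := (0 <= p.1) && (0 <= p.2).
pose P1 (p : int * int) := (p.1 < 0) && (p.2 < 0).
pose F0 p := if P0 p then hecke_term p else 0.
pose F1 p := if P1 p then hecke_term p else 0.
have sF0 : summable F0.
  by apply: summable_sub summable_hecke_term => p m; rewrite /F0; case: ifP.
have sF1 : summable F1.
  by apply: summable_sub summable_hecke_term => p m; rewrite /F1; case: ifP.
rewrite /hecke_series (@eq_fsum _ _ (fun p => F0 p + F1 p)); last first.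
  case=> r s; rewrite /F0 /F1 /P0 /P1 /hecke_term /= quadrantP.
  case: ifP => [/andP[r0 s0] | _]; first by rewrite ifF ?addr0 //; lia.
  by case: ifP; rewrite ?add0r // mul0r mon0.
have FE p : hecke_nat p.1 p.2 = F0 (Posz p.1, Posz p.2) + F1 (Negz p.2, Negz p.1).
  by rewrite hecke_natE.
pose h0 (p : nat * nat) := (Posz p.1, Posz p.2).
pose h1 (p : nat * nat) := (Negz p.2, Negz p.1).
pose h0' (p : int * int) := (`|p.1|%N, `|p.2|%N).
pose h1' (p : int * int) := (`|p.2|.-1%N, `|p.1|.-1%N).
have h0K : cancel h0 h0' by case.
have h1K : cancel h1 h1' by case.
rewrite (eq_fsum FE) fsumD // fsumD.
- congr (_ + _).
    by apply: (fsum_reindex h0K); case=> -[r|r] [s|s]; rewrite /F0 /P0 //= ?andbF eqxx.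
  by apply: (fsum_reindex h1K); case=> -[r|r] [s|s]; rewrite /F1 /P1 //= ?andbF eqxx.
- exact: (@summable_inj _ _ _ _ h0 h0' F0 h0K sF0).
- exact: (@summable_inj _ _ _ _ h1 h1' F1 h1K sF1).
Qed.

(** The terms G m j are those of a double series.  Summed over m first, they give
    the terms of phi(- q) sigma by [phi_term_sum]; summed over the diagonals
    m + j = n, they give those of the indefinite series by [inner_sum_qbin]. *)
Lemma phi_neg_sigma : phi_neg * (Psigma : fps) = hecke_series.
Proof.
have -> : (Psigma : fps) = fsum (fun j => sigma_term j : fps) by [].
have sS := sigma_term_summable.
rewrite -fsumMl //.
have SE j : phi_neg * (sigma_term j : fps) =
    even_fac q j * q ^+ 'C(j.+2, 2) * fsum (phi_term j).
  apply: (@fps_cancel (odd_fac j.+1)); first exact: odd_fac0.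
  rewrite mulrCA sigma_termE !mulrA -qfac_odd_even [RHS]mulrAC phi_term_sum; ring.
rewrite (eq_fsum SE).
pose G m j : fps := (-1) ^+ (m + j) * q ^+ 'C((m + j).+2, 2) * (1 - q ^+ (m + j).+1) *
  ((-1) ^+ j * q ^+ 'C(m, 2) * qbin q (2 * j + m).+1 m * even_fac q j).
have GE j m : G m j = even_fac q j * q ^+ 'C(j.+2, 2) * phi_term j m.
  rewrite /G /phi_term.
  transitivity ((-1) ^+ j * (-1) ^+ j * (-1) ^+ m * q ^+ ('C((m + j).+2, 2) + 'C(m, 2)) *
    (1 - q ^+ (m + j).+1) * qbin q (2 * j + m).+1 m * even_fac q j); first by rewrite !exprD; ring.
  have -> : ('C((m + j).+2, 2) + 'C(m, 2) = 'C(j.+2, 2) + (m ^ 2 + m + m * j))%N.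
    have := double_bin2 (m + j).+1; have := double_bin2 j.+1.
    by have := double_bin2 m; rewrite bin2S; nia.
  by rewrite -expr2 sqrr_sign exprD; ring.
have sG : summable (fun p : nat * nat => G p.1 p.2).
  move=> N; exists N => -[r s] m ltm; rewrite mem_box_prod !mem_box_nat /= => rs.
  apply: (@eqm0M N) => //; apply: eqm0M; apply: eqm0Ml; apply: eqm_q0.
  by have := double_bin2 (r + s).+1; nia.
transitivity (fsum (fun p : nat * nat => G p.1 p.2)).
  rewrite (fsum_swap (fun p => G p.1 p.2)) fsum_pair /=.
    apply: eq_fsum => j; rewrite (eq_fsum (GE j)) fsumMl //.
    exact: summable_eqm (eqm_phi_term j).
  have swapK : cancel (fun p : nat * nat => (p.2, p.1)) (fun p => (p.2, p.1)) by case.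
  exact: summable_inj swapK sG.
rewrite -fsum_diag // hecke_series_nat -fsum_diag; last exact: summable_hecke_nat.
apply: eq_fsum => n.
transitivity ((-1) ^+ n * q ^+ 'C(n.+2, 2) * (1 - q ^+ n.+1) * inner_sum q n); last first.
  rewrite /inner_sum mulr_sumr; apply: eq_bigr => j _; rewrite /hecke_nat.
  by rewrite subnK // -ltnS.
rewrite inner_sum_qbin mulr_sumr; apply: eq_bigr => j _; have ltj := ltn_ord j.
rewrite /G subnK; last by lia.
congr (_ * (_ * _ * _)).
have -> : ((n + j).+1 = (2 * j).+1 + (n - j))%N by lia.
have -> : ((2 * j + (n - j)).+1 = (2 * j).+1 + (n - j))%N by lia.
by rewrite -qbin_sym.
Qed.

(** * The odd part *)

Definition phi_pos : fps := fsum (fun t : int => mon 1 (t ^+ 2)).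

Lemma summable_phi_pos : summable (fun t : int => mon 1 (t ^+ 2)).
Proof.
apply: summable_mon => N; exists N => t _; rewrite mem_box_int => ltN; nia.
Qed.

(** Since a^2 + b^2 = 2 c^2 + 2 d^2 for a = c + d and b = c - d. *)
Lemma phi_pos_neg : phi_pos * phi_neg = theta 2 2 ^+ 2.
Proof.
rewrite fsumM; [|exact: summable_phi_pos|exact: summable_phi_neg].
have FE (p : int * int) : mon 1 (p.1 ^+ 2) * mon (eps p.2) (p.2 ^+ 2) =
    mon (eps p.2) (p.1 ^+ 2 + p.2 ^+ 2).
  by rewrite monM ?mul1r // sqr_ge0.
rewrite fsum_halve; first last.
- move=> a b ab; rewrite !FE /= monN addrC; congr mon.
  exact: eps_flip.
- exact: summableM summable_phi_pos summable_phi_neg.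
rewrite expr2 fsumM; [|exact: summable_theta|exact: summable_theta].
apply: eq_fsum => -[c d]; rewrite FE /= monM; [|nia|nia].
by rewrite epsD epsN; congr mon; ring.
Qed.

Definition odd_part (f : fps) : fps := fun m => if odd m then f m else 0.

Lemma odd_part_fsum (I : choiceType) (F : I -> fps) :
  odd_part (fsum F) = fsum (fun i => odd_part (F i)).
Proof.
apply: fpsP => m; rewrite /odd_part /fsum; case: ifP => // _.
by rewrite fsbig1.
Qed.

Lemma odd_part_evenM (e f : fps) : (forall n, odd n -> e n = 0) ->
  odd_part (e * f) = e * odd_part f.
Proof.
move=> e0; apply: fpsP => m; rewrite /odd_part fpsM.
case: ifP => om; [|apply/esym/big1 => i _]; rewrite ?fpsM; last first.
  case oi: (odd i); first by rewrite e0 ?mul0r.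
  by rewrite ifF ?mulr0 //; have := ltn_ord i; lia.
apply: eq_bigr => i _; case oi: (odd i); first by rewrite e0 ?mul0r.
by rewrite ifT //; have := ltn_ord i; lia.
Qed.

(** The exponent that t = 2 c - r gives in phi(q) times the indefinite series, for
    c = 0 and without the constant 1. *)
Definition slice_exp (r s : int) : int :=
  2 * r ^+ 2 + s ^+ 2 + 4 * r * s + 2 * r + 3 * s.

Definition slice_term (p : int * int) : fps :=
  mon (quadrant p.1 p.2 * eps (p.1 + p.2)) (slice_exp p.1 p.2).

Definition slice_series : fps := fsum slice_term.

Lemma slice_exp_bound r s : quadrant r s != 0 ->
  `|r|%:Z <= slice_exp r s + 1 /\ `|s|%:Z <= slice_exp r s + 1 /\ 0 <= slice_exp r s.
Proof.
rewrite quadrantP /slice_exp; case: ifP => [/andP[r0 s0] _ | _].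
  by split; [|split]; nia.
by case: ifP => // /andP[r0 s0] _; split; [|split]; nia.
Qed.

Lemma summable_slice_term : summable slice_term.
Proof.
apply: summable_mon => N; exists N.+1 => -[r s].
rewrite mem_box_prod !mem_box_int /= mulf_eq0 negb_or => /andP[/slice_exp_bound[r0 [s0 _]] _] ltN.
by apply/andP; split; lia.
Qed.

(** The shift (r, s) -> (r - c, s + 2 c) changes the exponent by a constant, but it
    moves the quadrants by w1 + w2, where w1 is a function of r supported in a
    vertical strip and w2 a function of s supported in a horizontal strip.  The
    exponent is invariant under s -> - (4 r + 3) - s for fixed r and under
    r -> - (2 s + 1) - r for fixed s; both reverse the sign, so the strips
    contribute 0. *)
Lemma slice_shift c :
  fsum (fun p : int * int => mon (quadrant p.1 p.2 * eps (p.1 + p.2))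
    ((2 * c - p.1) ^+ 2 + (p.1 ^+ 2 + p.2 ^+ 2 + 4 * p.1 * p.2 + 2 * p.1 + 3 * p.2 + 1)))
  = mon (eps c) (6 * c ^+ 2 + 4 * c + 1) * slice_series.
Proof.
pose C := 6 * c ^+ 2 + 4 * c + 1.
have C0 : 0 < C by rewrite /C; nia.
pose h (p : int * int) := (p.1 - c, p.2 + 2 * c).
pose h' (p : int * int) := (p.1 + c, p.2 - 2 * c).
rewrite (@fsum_reindex _ _ h h'); first last.
- by case=> r s _; rewrite /h /h' /=; congr pair; ring.
- by case=> r s; rewrite /h /h' /=; congr pair; ring.
pose G (w : int -> int -> int) (p : int * int) : fps :=
  mon (w p.1 p.2 * (eps c * eps (p.1 + p.2))) (slice_exp p.1 p.2 + C).
pose w1 (r s : int) := nonneg (r - c) - nonneg r.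
pose w2 (r s : int) := nonneg (s + 2 * c) - nonneg s.
have sG0 : summable (G quadrant).
  apply: summable_mon => N; exists N.+1 => -[r s].
  rewrite mem_box_prod !mem_box_int /= mulf_eq0 negb_or.
  move=> /andP[/slice_exp_bound[r0 [s0 _]] _] ltN.
  by apply/andP; split; lia.
have sG1 : summable (G w1).
  apply: summable_mon => N; exists (N + 4 * `|c| + 10)%N => -[r s].
  rewrite mem_box_prod !mem_box_int /= mulf_eq0 negb_or => /andP[w0 _] ltN.
  have r_le : (`|r| <= `|c|)%N.
    by move: w0; rewrite /w1 /nonneg; case: (leP 0 r); case: (leP 0 (r - c)) => //; lia.
  apply/andP; split; first by lia.
  rewrite leqNgt; apply/negP => lts; move: ltN; rewrite /slice_exp.
  have s_ge : (N%:Z + 4 * `|c|%:Z + 10 < s) \/ (s < - (N%:Z + 4 * `|c|%:Z + 10)) by lia.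
  case: s_ge => s_ge; nia.
have sG2 : summable (G w2).
  apply: summable_mon => N; exists (N + 4 * `|c| + 10)%N => -[r s].
  rewrite mem_box_prod !mem_box_int /= mulf_eq0 negb_or => /andP[w0 _] ltN.
  have s_le : (`|s| <= 2 * `|c|)%N.
    by move: w0; rewrite /w2 /nonneg; case: (leP 0 s); case: (leP 0 (s + 2 * c)) => //; lia.
  apply/andP; split; last by lia.
  rewrite leqNgt; apply/negP => ltr; move: ltN; rewrite /slice_exp.
  have r_ge : (N%:Z + 4 * `|c|%:Z + 10 < r) \/ (r < - (N%:Z + 4 * `|c|%:Z + 10)) by lia.
  case: r_ge => r_ge; nia.
have G1 : fsum (G w1) = 0.
  apply: (@fsum_invol _ (fun p => (p.1, - (4 * p.1 + 3) - p.2))).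
    by case=> r s /=; congr pair; ring.
  case=> r s; rewrite /G /= monN; congr mon; last by rewrite /slice_exp; ring.
  rewrite (@eps_flip (r + (- (4 * r + 3) - s)) (r + s)); first by rewrite /w1; ring.
  lia.
have G2 : fsum (G w2) = 0.
  apply: (@fsum_invol _ (fun p => (- (2 * p.2 + 1) - p.1, p.2))).
    by case=> r s /=; congr pair; ring.
  case=> r s; rewrite /G /= monN; congr mon; last by rewrite /slice_exp; ring.
  rewrite (@eps_flip (- (2 * s + 1) - r + s) (r + s)); first by rewrite /w2; ring.
  lia.
rewrite (@eq_fsum _ _ (fun p => G quadrant p + (G w1 p + G w2 p))); last first.
  case=> r s; rewrite /G /h /= !monD; congr mon; last by rewrite /slice_exp /C; ring.
  have -> : r - c + (s + 2 * c) = c + (r + s) by ring.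
  by rewrite (epsD c) /quadrant /w1 /w2; ring.
rewrite fsumD //; last exact: summableD.
rewrite fsumD // G1 G2 !addr0 /slice_series -fsumMl; last exact: summable_slice_term.
apply: eq_fsum => -[r s]; rewrite /G /slice_term /= monM.
- by rewrite /C; congr mon; ring.
- by rewrite -/C => _; apply: ltW.
by rewrite mulf_eq0 negb_or => /andP[/slice_exp_bound[_ []]].
Qed.

(** The exponent t^2 + r^2 + s^2 + 4 r s + 2 r + 3 s + 1 is odd exactly when
    t + r is even, because s^2 + 3 s is always even.  So the odd part is the sum
    over t = 2 c - r, and each c contributes a translate of the same series. *)
Lemma odd_part_phi_hecke :
  odd_part (phi_pos * hecke_series) = q * theta 6 2 * slice_series.
Proof.
have sP := summable_phi_pos; have sH := summable_hecke_term.
rewrite fsumM // odd_part_fsum.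
pose F (p : int * (int * int)) : fps := mon (quadrant p.2.1 p.2.2 * eps (p.2.1 + p.2.2))
  (p.1 ^+ 2 + (p.2.1 ^+ 2 + p.2.2 ^+ 2 + 4 * p.2.1 * p.2.2 + 2 * p.2.1 + 3 * p.2.2 + 1)).
have FE p : mon 1 (p.1 ^+ 2) * hecke_term p.2 = F p.
  case: p => t [r s]; rewrite /F /hecke_term /= monM ?mul1r //; first by rewrite sqr_ge0.
  rewrite mulf_eq0 negb_or quadrantP => /andP[+ _].
  case: ifP => [/andP[r0 s0] _ | _]; first by nia.
  by case: ifP => // /andP[r0 s0] _; nia.
have sF : summable F by apply: eq_summable FE _; apply: summableM sP sH.
rewrite (@eq_fsum _ _ (fun p => odd_part (F p))); last by move=> p; rewrite FE.
pose h (p : int * (int * int)) := (2 * p.1 - p.2.1, p.2).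
pose h' (p : int * (int * int)) := (((p.1 + p.2.1) %/ 2)%Z, p.2).
have hK : cancel h h' by case=> c [r s]; rewrite /h /h' /=; congr pair; lia.
have sq2 (x : int) : exists y, x ^+ 2 = x + 2 * y.
  have [k [-> | ->]] : exists k, x = 2 * k \/ x = 2 * k + 1 by exists (x %/ 2)%Z; lia.
    by exists (2 * k ^+ 2 - k); ring.
  by exists (2 * k ^+ 2 + k); ring.
rewrite (@fsum_reindex _ _ h h'); first last.
- case=> t [r s] Fn0; rewrite /h /h' /=; congr pair.
  have : exists m, odd m /\ m%:Z = t ^+ 2 + (r ^+ 2 + s ^+ 2 + 4 * r * s + 2 * r + 3 * s + 1).
    apply: contrapT => nm; move/eqP: Fn0; apply; apply: fpsP => m.
    rewrite /odd_part fps0 /F /mon /=; case: ifP => // om; case: eqP => // me.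
    by case: nm; exists m.
  case=> m [om]; have [y ->] := sq2 t; have [z ->] := sq2 r; have [w ->] := sq2 s.
  by lia.
- exact: hK.
rewrite (@eq_fsum _ _ (F \o h)); last first.
  case=> c [r s]; apply: fpsP => m; rewrite /odd_part; case: ifP => // em.
  rewrite /F /h /mon /=; case: eqP => // me; exfalso; move: me.
  have [y ->] := sq2 (2 * c - r); have [z ->] := sq2 r; have [w ->] := sq2 s.
  by lia.
rewrite fsum_pair; last exact: summable_inj hK sF.
rewrite (@eq_fsum _ _ (fun c => slice_series * (q * mon (eps c) (6 * c ^+ 2 + 4 * c)))); last first.
  move=> c; rewrite mulrC -[RHS]/(_ * slice_series) /q monM //; last by move=> _; nia.
  by rewrite mul1r [1 + _]addrC -slice_shift.
rewrite fsumMl; last first.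
  by apply: summableMl; apply: eq_summable (@summable_theta 6 2 isT isT).
rewrite fsumMl; last by apply: eq_summable (@summable_theta 6 2 isT isT).
by rewrite mulrC.
Qed.

(** * Evaluation of the slice *)

Lemma summable_quadrant_line n c e :
  summable (fun s : int => mon (quadrant (n - 1 - s) s * c) e).
Proof.
move=> N; exists `|n|%N => s m _; rewrite mem_box_int quadrantP => sn.
case: ifP => [/andP[? ?] | _]; first by lia.
by case: ifP => [/andP[? ?] | _]; [lia | rewrite mul0r mon0].
Qed.

(** By induction on n in both directions: passing from n to n + 1 changes the
    weight only at s = n, by 1. *)
Lemma quadrant_line_sum n c e :
  fsum (fun s : int => mon (quadrant (n - 1 - s) s * c) e) = mon (n * c) e.
Proof.
pose L n := fsum (fun s : int => mon (quadrant (n - 1 - s) s * c) e).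
have LS m : L (m + 1) = L m + mon c e.
  apply/eqP; rewrite [L m + _]addrC -subr_eq /L -fsumB; try exact: summable_quadrant_line.
  rewrite (@fsum1 _ m).
    by rewrite monN monD; apply/eqP; congr mon; rewrite /quadrant /nonneg; case: (leP 0 m); lia.
  move=> s sm; rewrite monN monD (_ : _ + _ = 0) ?mon0 //.
  by rewrite /quadrant /nonneg; case: (leP 0 (m + 1 - 1 - s)); case: (leP 0 (m - 1 - s)); lia.
rewrite -/(L n); elim/int_rec: n => [|n IHn|n IHn].
- rewrite mul0r mon0; apply: fsum_eq0 => s; rewrite (_ : quadrant _ _ = 0) ?mul0r ?mon0 //.
  by rewrite quadrantP; case: ifP => [/andP[] | _]; [lia | case: ifP => // /andP[]; lia].
- have -> : n.+1%:Z = n%:Z + 1 by lia.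
  by rewrite LS IHn monD; congr mon; ring.
apply: (addIr (mon c e)); rewrite -LS.
have -> : - n.+1%:Z + 1 = - n%:Z by lia.
by rewrite IHn monD; congr mon; lia.
Qed.

(** For fixed b these are the terms of phi(- q ^ 2) times [slice_series] in which
    the second of the two merged variables is b; n is the sum of the first one and
    s. *)
Definition appell_exp (b n s : int) : int := n ^+ 2 + n + b ^+ 2 + b + 2 * (b + 1) * s.

Definition appell_term (b : int) (p : int * int) : fps :=
  mon (quadrant (p.1 - p.2 + b) p.2 * eps p.1) (appell_exp b p.1 p.2).

Lemma appell_exp_bound b n s : quadrant (n - s + b) s != 0 ->
  [/\ `|n - s|%:Z <= appell_exp b n s + 2, `|s|%:Z <= appell_exp b n s + 2,
      `|b|%:Z <= appell_exp b n s + 2 & 0 <= appell_exp b n s].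
Proof.
have -> : appell_exp b n s = (n - s) ^+ 2 + b ^+ 2 + (n - s + b) + 2 * (n - s + b) * s + s ^+ 2 + 3 * s.
  by rewrite /appell_exp; ring.
move: (n - s) => a; rewrite quadrantP; case: ifP => [/andP[r0 s0] _ | _].
  have ? : 0 <= (a + b) * s by apply: mulr_ge0.
  by split; nia.
case: ifP => // /andP[r0 s0] _.
have ? : 0 <= (- (a + b) - 1) * (- s - 1) by apply: mulr_ge0; lia.
by split; nia.
Qed.

Lemma summable_appell_term b : summable (appell_term b).
Proof.
apply: summable_mon => N; exists (N + N + 4)%N => -[n s].
rewrite mem_box_prod !mem_box_int /= mulf_eq0 negb_or.
move=> /andP[/appell_exp_bound[n0 s0 _ _] _] ltN.
by apply/andP; split; lia.
Qed.

(** Multiplication by q ^ (2 |b + 1|) is a shift of s by 1 or - 1, so the series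
    times 1 - q ^ (2 |b + 1|) only involves the boundary lines of the quadrants,
    on which s or n - s is constant.  The exponent on each line is a quadratic
    polynomial of n with a symmetry that changes the parity of n. *)
Lemma appell_vanish b : b + 1 != 0 -> fsum (appell_term b) = 0.
Proof.
move=> b1; pose d := Num.sg (b + 1).
have dE : d * (b + 1) = `|(b + 1)%R|%N%:Z by rewrite /d abszE normrEsg.
have d1 : (d = 1) \/ (d = -1) by rewrite /d; case: (sgrP (b + 1)) b1 => // *; [left|right].
have b1' : (0 < 2 * `|(b + 1)%R|)%N by lia.
have sX := summable_appell_term b.
apply: (@fps_cancel (1 - q ^+ (2 * `|(b + 1)%R|))).
  by rewrite fpsD fpsN coef_qn fps1; case: (2 * _)%N b1'.
rewrite mulr0 mulrBl mul1r -fsumMl //.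
pose h (p : int * int) := (p.1, p.2 - d).
have -> : fsum (fun p => q ^+ (2 * `|(b + 1)%R|) * appell_term b p) =
    fsum (fun p : int * int => mon (quadrant (p.1 - p.2 + d + b) (p.2 - d) * eps p.1)
                                   (appell_exp b p.1 p.2)).
  rewrite (@fsum_reindex _ _ h (fun p => (p.1, p.2 + d))); first last.
  - by case=> n s _; rewrite /h /= addrK.
  - by case=> n s; rewrite /h /= subrK.
  apply: eq_fsum => -[n s]; rewrite /h /= qE monM //.
    rewrite mul1r; congr mon; first by rewrite /=; congr (quadrant _ _ * _); ring.
    by rewrite /= PoszM -dE /appell_exp; ring.
  by rewrite mulf_eq0 negb_or => /andP[/appell_exp_bound[]].
pose G (w : int -> int -> int) (p : int * int) : fps :=
  mon (w p.1 p.2 * eps p.1) (appell_exp b p.1 p.2).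
pose w1 (n s : int) := nonneg s - nonneg (s - d).
pose w2 (n s : int) := nonneg (n - s + b) - nonneg (n - s + d + b).
have sG1 : summable (G w1).
  apply: summable_mon => N; exists (N + 4 * (`|b| + 3) ^ 2)%N => -[n s].
  rewrite mem_box_prod !mem_box_int /= mulf_eq0 negb_or => /andP[w0 _] ltN.
  have s1 : (`|s| <= 1)%N.
    by move: w0; rewrite /w1 /nonneg; case: (leP 0 s); case: (leP 0 (s - d)) => //; lia.
  apply/andP; split; last by nia.
  move: ltN; rewrite /appell_exp => ltN.
  have ? : `|n|%:Z - 1 <= n ^+ 2 + n by nia.
  have ? : 0 <= b ^+ 2 + b by nia.
  have ? : - (2 * (`|b|%:Z + 1)) <= 2 * (b + 1) * s by nia.
  have : `|n|%N%:Z < N%:Z + 2 * `|b|%N%:Z + 3 by lia.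
  by move: (`|n|%N) (`|b|%N) => x y; clear; nia.
have sG2 : summable (G w2).
  apply: summable_mon => N; exists (N + 4 * (`|b| + 3) ^ 2)%N => -[n s].
  rewrite mem_box_prod !mem_box_int /= mulf_eq0 negb_or => /andP[w0 _] ltN.
  have [k [k1 sE]] : exists k, (k = 0 \/ k = -1) /\ s = n + b - k.
    exists (n - s + b); split; last by ring.
    by move: w0; rewrite /w2 /nonneg; case: (leP 0 (n - s + b));
       case: (leP 0 (n - s + d + b)) => //; lia.
  have eE : appell_exp b n s =
      (n + b + 1) ^+ 2 + (n + b + 1) + 2 * (b + 1) * (b - k - 1).
    by rewrite /appell_exp sE; ring.
  have ? : `|n + b + 1| - 1 <= (n + b + 1) ^+ 2 + (n + b + 1) by nia.
  have ? : - (2 * (`|b|%:Z + 1) ^+ 2) <= 2 * (b + 1) * (b - k - 1) by case: k1 => ->; nia.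
  have mB : `|n + b + 1| < N%:Z + 2 * (`|b|%:Z + 1) ^+ 2 + 1 by lia.
  have nB : `|n|%N%:Z <= `|n + b + 1| + `|b|%N%:Z + 1 by clear; lia.
  have sB : `|s|%N%:Z <= `|n + b + 1| + `|b|%N%:Z + 1 by clear -k1 sE; lia.
  move: mB nB sB; move: `|n + b + 1| (`|n|%N) (`|s|%N) (`|b|%N) => M x y z; clear.
  by move=> mB nB sB; apply/andP; split; nia.
have G1 : fsum (G w1) = 0.
  apply: (@fsum_invol _ (fun p => (- 1 - p.1, p.2))).
    by case=> n s /=; congr pair; ring.
  case=> n s; rewrite /G /= monN; congr mon; last by rewrite /appell_exp; ring.
  by rewrite (@eps_flip (- 1 - n) n) /w1; [ring | lia].
have G2 : fsum (G w2) = 0.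
  apply: (@fsum_invol _ (fun p => (- 1 - 2 * (b + 1) - p.1, p.2 - 1 - 2 * (b + 1) - 2 * p.1))).
    by case=> n s /=; congr pair; ring.
  case=> n s; rewrite /G /= monN; congr mon; last by rewrite /appell_exp; ring.
  rewrite (@eps_flip (- 1 - 2 * (b + 1) - n) n) /w2; last by lia.
  have -> : - 1 - 2 * (b + 1) - n - (s - 1 - 2 * (b + 1) - 2 * n) = n - s by ring.
  ring.
have sX' : summable (fun p : int * int =>
    mon (quadrant (p.1 - p.2 + d + b) (p.2 - d) * eps p.1) (appell_exp b p.1 p.2)).
  have := summableD sX (summableN (summableD sG1 sG2)).
  apply: eq_summable => -[n s]; rewrite /G /appell_term /= monD monN monD; congr mon.
  by rewrite /quadrant /w1 /w2; ring.
rewrite -fsumN -fsumD //; last exact: summableN.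
rewrite (@eq_fsum _ _ (fun p => G w1 p + G w2 p)); last first.
  case=> n s; rewrite /G /appell_term /= monN !monD; congr mon.
  by rewrite /quadrant /w1 /w2; ring.
by rewrite fsumD // G1 G2 addr0.
Qed.

(** For b = - 1 the exponent does not depend on s, and the sum over s counts the
    points of a line with the signs of the quadrants. *)
Lemma appell_cube : fsum (appell_term (- 1)) = cube_series.
Proof.
rewrite fsum_pair; last exact: summable_appell_term.
apply: eq_fsum => n; rewrite [eps n * n]mulrC -quadrant_line_sum; apply: eq_fsum => s.
rewrite /appell_term /=; congr mon; last by rewrite /appell_exp; ring.
by congr (quadrant _ _ * _); ring.
Qed.

(** With a = r + d and b = r - d the sums over r and d become sums over a and b of
    equal parity; pairs of different parity may be added, since they cancel under
    the exchange of a and b.  Then the sum is taken for fixed b. *)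
Lemma slice_product : theta 2 2 * slice_series = cube_series.
Proof.
pose W (a b s : int) : fps := mon (quadrant (a + b) s * eps (a + s))
  (a ^+ 2 + a + b ^+ 2 + b + 2 * (a + b) * s + s ^+ 2 + 3 * s).
have WE a b s : W a b s = appell_term b (a + s, s).
  rewrite /W /appell_term /= addrK; congr mon; rewrite /appell_exp; ring.
have sW : summable (fun p : (int * int) * int => W p.1.1 p.1.2 p.2).
  apply: summable_mon => N; exists (N + 4)%N => -[[a b] s].
  rewrite !mem_box_prod !mem_box_int /= mulf_eq0 negb_or => /andP[W0 _] ltN.
  have := @appell_exp_bound b (a + s) s; rewrite addrK => /(_ W0)[].
  have -> : appell_exp b (a + s) s =
      a ^+ 2 + a + b ^+ 2 + b + 2 * (a + b) * s + s ^+ 2 + 3 * s by rewrite /appell_exp; ring.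
  by move=> *; apply/andP; split; [apply/andP; split|]; lia.
have sV : summable (fun p : int * (int * int) => W p.2.1 p.1 p.2.2).
  apply: (@summable_inj _ _ _ _ (fun p => ((p.2.1, p.1), p.2.2))
            (fun p => (p.1.2, (p.1.1, p.2))) _ _ sW).
  by case=> ? [].
transitivity (fsum (fun p : (int * int) * int => W p.1.1 p.1.2 p.2)); last first.
  rewrite (@fsum_reindex _ _ (fun p : int * (int * int) => ((p.2.1, p.1), p.2.2))
            (fun p => (p.1.2, (p.1.1, p.2)))) /=; [|by case=> ? []|by case=> -[]].
  rewrite fsum_pair // -appell_cube (@fsum1 _ (- 1)).
    rewrite [RHS](@fsum_reindex _ _ (fun p => (p.1 + p.2, p.2)) (fun p => (p.1 - p.2, p.2))).
    - by apply: eq_fsum => -[a s]; rewrite WE.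
    - by case=> a s /=; rewrite addrK.
    - by case=> a s _ /=; rewrite subrK.
  move=> b b1; rewrite -(@appell_vanish b); last by apply: contra b1 => /eqP ?; apply/eqP; lia.
  rewrite [RHS](@fsum_reindex _ _ (fun p => (p.1 + p.2, p.2)) (fun p => (p.1 - p.2, p.2))).
  - by apply: eq_fsum => -[a s]; rewrite WE.
  - by case=> a s /=; rewrite addrK.
  - by case=> a s _ /=; rewrite subrK.
rewrite fsum_pair // fsum_halve; first last.
- move=> a b ab; rewrite -fsumN; apply: eq_fsum => s; rewrite /W /= monN [b + a]addrC.
  congr mon; last by ring.
  by rewrite !epsD (eps_flip ab); ring.
- exact: (summable_fsum sW).
have sT : summable (fun c : int => mon (eps c) (2%:Z * c ^+ 2 + (2%:Z - 2%:Z) * c)).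
  exact: summable_theta.
rewrite /theta /slice_series fsumM //; last exact: summable_slice_term.
pose h (p : (int * int) * int) := (p.1.2, (p.1.1, p.2)).
rewrite (@fsum_reindex _ _ h (fun p => ((p.2.1, p.1), p.2.2))); [|by case=> -[]|by case=> ? []].
rewrite fsum_pair; last first.
  have hK : cancel h (fun p => ((p.2.1, p.1), p.2.2)) by case=> -[].
  exact: summable_inj hK (summableM sT summable_slice_term).
apply: eq_fsum => -[r d] /=; apply: eq_fsum => s; rewrite /W /slice_term /= monM.
- congr mon; last by rewrite /slice_exp; ring.
  have -> : r + d + (r - d) = 2 * r by ring.
  rewrite !epsD.
  have -> : quadrant (2 * r) s = quadrant r s by rewrite /quadrant /nonneg pmulr_rge0.
  ring.
- by nia.
by rewrite mulf_eq0 negb_or => /andP[/slice_exp_bound[_ []]].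
Qed.

(** * Conclusion *)

(** The generating function of p_2d in the variable q ^ 2, as it appears in the odd
    part of sigma: the factor (l_2 / l_1) ^ 2 is (-q; q)_oo ^ 2. *)
Lemma p2d_coef m : (p2d m%:Z)%:Z = (prN 2 2 ^+ 2) (2 * m)%N.
Proof.
rewrite p2d_gen.
have -> : \prod_(i < m) (1 - 'X^(2 * i.+1)) =
    \prod_(i < m) (1 - 'X^(i.+1)) * \prod_(i < m) (1 + 'X^(i.+1)) :> {poly int}.
  rewrite -big_split /=; apply: eq_bigr => i _.
  by rewrite mulnC exprM -subr_sqr expr1n.
rewrite exprMn fps_div_mulK; last first.
  rewrite -horner_coef0 horner_exp horner_prod big1 ?expr1n // => i _.
  by rewrite hornerD hornerN hornerXn hornerC expr0n subr0.
have E : eqm (2 * m).+1 (prN 2 2) (\prod_(k < m) (1 + q ^+ (2 * k + 2))).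
  apply: eqm_pinf_tail => [|k lemk]; first exact: unital_prN.
  by rewrite -[X in eqm _ _ X]addr0; apply: eqmD => //; apply: eqm_q0; lia.
set p := (\prod_(i < m) (1 + 'X^(i.+1))) ^+ 2.
transitivity ((p \Po 'X^2)`_(2 * m)).
  by rewrite coef_comp_poly_Xn // dvdn_mulr // mulKn.
rewrite [prN 2 2 ^+ 2]expr2 (eqmM E E) // -/(of_poly _ (2 * m)%N) /p rmorphXn rmorph_prod.
rewrite [(\prod_(i < m) _) ^+ 2]expr2 of_polyM of_poly_prod.
apply: (congr1 (fun f : fps => f (2 * m)%N)); congr (_ * _); apply: eq_bigr => i _;
  by rewrite rmorphD rmorph1 /= comp_Xn_poly -exprM of_polyD of_poly1 of_polyXn mulnS addnC.
Qed.

Lemma theta22_even n : odd n -> theta 2 2 n = 0.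
Proof.
move=> on; apply: fsbig1 => c _; rewrite /mon; case: eqP => // E; exfalso.
by move: E; lia.
Qed.

Lemma theta22_0 : theta 2 2 0%N = 1.
Proof. by rewrite theta_product // !fpsM0 !pr0 // !mulr1. Qed.

Lemma odd_part_sigma : odd_part (Psigma : fps) = q * (prN 2 2 ^+ 2 * psi3).
Proof.
apply: (@fps_cancel (theta 2 2 ^+ 3)).
  by rewrite !exprS expr0 !fpsM0 theta22_0.
have T_even n : odd n -> (theta 2 2 ^+ 2) n = 0.
  move=> on; rewrite expr2 fpsM big1 // => i _; have lti := ltn_ord i.
  case oi: (odd i); first by rewrite theta22_even ?mul0r.
  by rewrite [X in _ * X]theta22_even ?mulr0 //; lia.
transitivity (theta 2 2 * (theta 2 2 ^+ 2 * odd_part Psigma)); first by ring.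
rewrite -(odd_part_evenM _ T_even) -phi_pos_neg -mulrA phi_neg_sigma odd_part_phi_hecke.
transitivity (q * theta 6 2 * (theta 2 2 * slice_series)); first by ring.
rewrite slice_product.
transitivity (q * (theta 2 2 ^+ 3 * (prN 2 2 ^+ 2 * psi3))); last by ring.
rewrite product_identity; ring.
Qed.

Theorem theorem4p4 (n : nat) :
  Psigma (2 * n + 1) =
  \sum_(k \in [set: nat]%classic)
     (p2d (n%:Z - ((3 * k ^ 2 + 3 * k) %/ 2)%N%:Z))%:Z.
Proof.
have -> : Psigma (2 * n + 1) = odd_part Psigma (2 * n + 1).
  by rewrite /odd_part ifT //; lia.
rewrite odd_part_sigma -(expr1 q) coef_qnM ifF; last by lia.
rewrite addnK /psi3 -fsumMl; last first.
  by apply: summable_eqm => k; apply: eqm_q0; nia.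
apply: eq_fsbigr => k _; rewrite mulrC coef_qnM.
have tE : (3 * k * k.+1 = 2 * ((3 * k ^ 2 + 3 * k) %/ 2))%N.
  have -> : (3 * k ^ 2 + 3 * k = 3 * 'C(k.+1, 2) * 2)%N by have := double_bin2 k; lia.
  by rewrite mulnK //; have := double_bin2 k; lia.
rewrite tE; move: (_ %/ 2)%N => t; case: ltnP => [ltnt | letn].
  by have -> : n%:Z - t%:Z = Negz (t - n.+1) by lia.
have -> : n%:Z - t%:Z = (n - t)%N%:Z by lia.
rewrite p2d_coef; congr (_ _); lia.
Qed.
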